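(* Let $\lambda>0$, let $(\nu_\xi)_{\xi\in\mathbb{R}^N}$ be a family of Lévy measures on $\mathbb{R}^N$ satisfying (M1), (M2), (M3) and (M4) below, with associated nonlocal operators $\mathcal I_\xi$, and let $H:\mathbb{R}^N\times\mathbb{R}^N\to\mathbb{R}$ be a continuous function satisfying (H1) and (H2) below. If $u\in USC(\mathbb{R}^N)\cap L^\infty(\mathbb{R}^N)$ is a viscosity subsolution and $v\in LSC(\mathbb{R}^N)\cap L^\infty(\mathbb{R}^N)$ is a viscosity supersolution of $$\lambda u-\mathcal I_x u(x)+H(x,Du)=0\quad\text{in }\mathbb{R}^N,$$ then $u\le v$ in $\mathbb{R}^N$. (M1) There is $C_\nu>0$ with $\sup_{\xi\in\mathbb{R}^N}\int_{\mathbb{R}^N}\min(1,|z|^2)\,\nu_\xi(dz)\le C_\nu$. (M2) $\sup_{\xi\in\mathbb{R}^N}\nu_\xi(\mathbb{R}^N\setminus B_R)\to0$ as $R\to\infty$. (M3) For all $0<r<R$ there is a modulus of continuity $\omega_{R,r}$ such that $|\nu_x-\nu_y|(B_R\setminus B_r)\le\omega_{R,r}(|x-y|)$ for all $x,y\in\mathbb{R}^N$. (M4) There are $r_0\in(0,1)$ and a function $o:(0,r_0)\to[0,\infty)$ with $o(r)\to0$ as $r\to0$ such that $W_2(\nu_x,\nu_y)(B_r)\le o(r)\,|x-y|^{1/2}$ for all $0<r<r_0$ and all $x,y\in\mathbb{R}^N$. (H1) There are $m>1$ and moduli of continuity $\omega_H^1,\omega_H^2$ such that for all $x,y,p,q\in\mathbb{R}^N$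 with $|q|\le1$, $H(y,p+q)-H(x,p)\le\omega_H^1(|x-y|)(1+|p|^m)+\omega_H^2(|q|)(1+|p|^{m-1})$. (H2) With the same $m>1$, there are constants $b_m,b_0>0$, $\rho_0>0$ and $\mu_0\in(0,1)$ such that for all $\mu\in[\mu_0,1]$ and $x,p\in\mathbb{R}^N$ with $|p|\ge\rho_0$, $\mu H(x,\mu^{-1}p)-H(x,p)\ge(1-\mu)(b_m|p|^m-b_0)$.
   Context: $B_r(x)$ is the open ball of radius $r$ centered at $x$ in $\mathbb{R}^N$, $B_r=B_r(0)$, $B=B_1$. $USC$/$LSC$ denote upper/lower semicontinuous functions. A modulus of continuity is a function $\omega:[0,\infty)\to[0,\infty)$ with $\omega(s)\to0$ as $s\to0$. A Lévy measure on $A\subset\mathbb{R}^N$ is a positive Borel measure $\nu$ on $A$ with $\nu(\{0\})=0$ and $\int_{A\setminus\{0\}}\min(1,|z|^2)\nu(dz)<\infty$. Nonlocal operators: $\mathcal I_\xi u(x)=\int_{\mathbb{R}^N}\big(u(x+z)-u(x)-\mathbf 1_B(z)Du(x)\cdot z\big)\nu_\xi(dz)$. For $A\subset\mathbb{R}^N$ measurable, $\mathcal I[A](x,p,\phi)=\int_A\big(\phi(x+z)-\phi(x)-\mathbf 1_B(z)\,p\cdot z\big)\nu_x(dz)$, and $\mathcal I[A](x,\phi)=\mathcal I[A](x,D\phi(x),\phi)$ when $\phi$ is $C^2$ near $x$. Viscosity solutions: $u\in USC(\mathbb{R}^N)\cap L^\infty(\mathbb{R}^N)$ is a viscosity subsolution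 if, for every $\bar x\in\mathbb{R}^N$, $\delta>0$ and $\phi\in C^2(B_1(\bar x))\cap L^\infty(\mathbb{R}^N)$ such that $\bar x$ is a maximum point of $u-\phi$ in $B_\delta(\bar x)$, $$\lambda u(\bar x)-\mathcal I[B_\delta](\bar x,\phi)-\mathcal I[B_\delta^c](\bar x,D\phi(\bar x),u)+H(\bar x,D\phi(\bar x))\le0.$$ A function in $LSC(\mathbb{R}^N)\cap L^\infty(\mathbb{R}^N)$ is a viscosity supersolution if the same holds with ''minimum'' in place of ''maximum'' and $\ge0$ in place of $\le0$. Total variation: $|\nu_1-\nu_2|=(\nu_1-\nu_2)^++(\nu_1-\nu_2)^-$ is the total variation (Jordan decomposition) of the signed measure $\nu_1-\nu_2$ on $\mathbb{R}^N\setminus\{0\}$ (Lévy measures are finite on sets bounded away from $0$). Wasserstein distance: for $0\in A\subset B$ and Lévy measures $\nu_1,\nu_2$ on $A$, $\mathrm{Adm}_A(\nu_1,\nu_2)$ is the set of positive measures $\gamma$ on $A\times A$ with $\gamma(\{(0,0)\})=0$ and $(\pi^i_\#\gamma)|_{A\setminus\{0\}}=\nu_i$, $i=1,2$, where $\pi^i(z_1,z_2)=z_i$ (the mass of the marginals at the origin is unconstrained). For $p\in[1,2]$, $W_p(\nu_1,\nu_2)(B_r)=\Big(\inf_{\gamma\in\mathrm{Adm}_{B_r}(\nu_1|_{B_r},\nu_2|_{B_r})}\int_{B_r\times B_r}|z_1-z_2|^p\,d\gamma(z_1,z_2)\Big)^{1/p}$. *)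

(* Defs.v *)
From mathcomp Require Export all_boot all_order all_algebra.
From mathcomp Require Export all_classical all_reals all_analysis.
From mathcomp Require Export measurable_realfun.
Export Order.TTheory GRing.Theory Num.Theory.
Export numFieldNormedType.Exports.

Set Implicit Arguments.
Unset Strict Implicit.
Unset Printing Implicit Defensive.

Global Open Scope classical_set_scope.
Global Open Scope ring_scope.

(* R^N with its Borel sigma-algebra. *)
Notation borel R N := (g_sigma_algebraType (@open 'rV[R]_N)).

Section Euclidean.
Context {R : realType} {N : nat}.
Implicit Types (x y p : 'rV[R]_N) (r s : R).

Definition dot x y : R := \sum_(i < N) x ord0 i * y ord0 i.

(* The norm of the canonical instance on 'rV[R]_N is the sup norm; it induces
   the right topology, but |x| and balls are Euclidean here. *)
Definition enorm x : R := Num.sqrt (dot x x).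

Definition eball x r : set 'rV[R]_N := [set y | enorm (y - x) < r].

Definition annulus r s : set 'rV[R]_N := eball 0 s `\` eball 0 r.

Definition grad (phi : 'rV[R]_N -> R) x : 'rV[R]_N :=
  \row_(i < N) 'D_(delta_mx ord0 i) phi x.

(* C^2 on an open set U: all partial derivatives of order at most 2 exist and
   are continuous on U. *)
Definition C2_on (U : set 'rV[R]_N) (phi : 'rV[R]_N -> R) : Prop :=
  forall x, U x ->
    {for x, continuous phi} /\
    forall i : 'I_N, let di := 'D_(delta_mx ord0 i) phi in
      [/\ derivable phi x (delta_mx ord0 i),
          {for x, continuous di} &
          forall j : 'I_N,
            derivable di x (delta_mx ord0 j) /\
            {for x, continuous ('D_(delta_mx ord0 j) di)}].

(* Bounded everywhere, not just up to a Lebesgue-null set: the measures nu_xi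
   may charge Lebesgue-null sets and solutions are tested pointwise. *)
Definition Linfty (f : 'rV[R]_N -> R) : Prop :=
  measurable_fun [set: borel R N] (f : borel R N -> R) /\
  exists M : R, forall x, `|f x| <= M.

Definition upper_semicontinuous (f : 'rV[R]_N -> R) : Prop :=
  forall x (a : R), f x < a -> \forall y \near x, f y < a.

End Euclidean.

Definition modulus {R : realType} (omega : R -> R) : Prop :=
  (forall s, 0 <= s -> 0 <= omega s) /\ omega s @[s --> 0^'+] --> (0 : R).

Section LevyMeasure.
Local Open Scope ereal_scope.
Context {R : realType} {N : nat}.

Definition levy_weight (z : 'rV[R]_N) : R := Num.min 1%R (enorm z ^+ 2)%R.

Definition levy_measure (nu : {measure set (borel R N) -> \bar R}) : Prop :=
  nu [set 0%R] = 0 /\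
  \int[nu]_(z in ~` [set 0%R]) (levy_weight z)%:E < +oo.

Lemma continuous_enorm : continuous (@enorm R N).
Proof.
move=> x; rewrite /enorm.
apply: (@continuous_comp _ _ _ (fun x : 'rV[R]_N => dot x x) (@Num.sqrt R));
  last exact: sqrt_continuous.
rewrite /dot; apply: (@continuous_big _ _ +%R 0%R) => [y|i _ z].
  exact: add_continuous.
by apply: (@cvgM _ _ (nbhs z)); exact: (@coord_continuous R 1 N ord0 i z).
Qed.

Lemma measurable_enorm :
  measurable_fun [set: borel R N] (@enorm R N : borel R N -> R).
Proof.
apply: (measurability _ (RGenOpens.measurableE R)).
move=> _ [_ [a [b ->] <-]]; rewrite setTI; apply: sub_sigma_algebra.
by move/continuousP : continuous_enorm; apply; exact: interval_open.
Qed.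

Lemma measurable_eball0 (r : R) : measurable (eball 0 r : set (borel R N)).
Proof.
rewrite (_ : eball 0 r = [set: borel R N] `&` enorm @^-1` `]-oo, r[%classic).
  by apply: measurable_enorm => //; exact: measurable_itv.
by rewrite setTI; apply/seteqP; split => z; rewrite /eball/= subr0 in_itv/=.
Qed.

Lemma measurable_annulus (r s : R) :
  measurable (annulus r s : set (borel R N)).
Proof. by apply: measurableD; exact: measurable_eball0. Qed.

Lemma levy_annulus_fin (nu : {measure set (borel R N) -> \bar R}) (r s : R) :
  levy_measure nu -> (0 < r)%R -> nu (annulus r s) < +oo.
Proof.
move=> [_ nufin] r0; set A : set (borel R N) := annulus r s.
have mA : measurable A by exact: measurable_annulus.
pose c : R := Num.min 1%R (r ^+ 2)%R.
have c0 : (0 < c)%R by rewrite lt_min ltr01 exprn_gt0.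
have mw : measurable_fun [set: borel R N]
    (EFin \o levy_weight : borel R N -> \bar R).
  apply/measurable_EFinP; apply: measurable_minr => //.
  by apply: measurable_funX; exact: measurable_enorm.
have w0 z : 0 <= (levy_weight z)%:E.
  by rewrite lee_fin le_min ler01 exprn_ge0// sqrtr_ge0.
have mN0 : measurable (~` [set 0%R] : set (borel R N)).
  apply: sub_sigma_algebra; apply: closed_openC.
  by apply: accessible_closed_set1; apply: hausdorff_accessible;
    exact: norm_hausdorff.
have AN0 : A `<=` ~` [set 0%R].
  move=> z [_ /= /negP]; rewrite /eball/= subr0 -leNgt => rz z0.
  by move: rz; rewrite z0 /enorm /dot big1 => [|i _];
    rewrite ?mxE ?mulr0// sqrtr0 leNgt r0.
have : c%:E * nu A < +oo.
  rewrite -integral_cst//; apply: le_lt_trans nufin.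
  apply: (@le_trans _ _ (\int[nu]_(z in A) (levy_weight z)%:E)).
    apply: ge0_le_integral => //.
    - by move=> z _; rewrite lee_fin ltW.
    - exact: measurable_funTS.
    - move=> z [_ /= /negP]; rewrite /eball/= subr0 -leNgt => rz.
      rewrite lee_fin /levy_weight /c le_min !ge_min lexx/=.
      by rewrite lerXn2r ?orbT// nnegrE; [exact: ltW|exact: sqrtr_ge0].
  by apply: ge0_subset_integral => //; exact: measurable_funTS.
by case: (nu A) => [a||]; rewrite ?ltry ?gt0_muley ?lte_fin ?ltNyr.
Qed.

End LevyMeasure.

(* Total variation of the signed measure mu1 - mu2 restricted to a set D on
   which both measures are finite. *)
Definition total_variation d (T : measurableType d) (R : realType)
    (mu1 mu2 : {measure set T -> \bar R}) (D : set T) (mD : measurable D)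
    (fin1 : (mu1 D < +oo)%E) (fin2 : (mu2 D < +oo)%E) : set T -> \bar R :=
  let diff := cadd (charge_of_finite_measure (mfrestr mD fin1))
                   (copp (charge_of_finite_measure (mfrestr mD fin2))) in
  let PH := cid (Hahn_decomposition diff) in
  let NH := cid (svalP PH) in
  charge_variation (svalP NH).

Section Wasserstein.
Local Open Scope ereal_scope.
Context {R : realType} {N : nat}.
Implicit Types (nu : {measure set (borel R N) -> \bar R}) (A : set 'rV[R]_N).

(* A measure on A x A is encoded as a measure on R^N x R^N that vanishes
   outside A x A. Only the values of nu1, nu2 on Borel subsets of A \ {0} are
   used, so they stand for their own restrictions to A. *)
Definition admissible A nu1 nu2 :
    set {measure set (borel R N * borel R N)%type -> \bar R} :=
  [set g : {measure set (borel R N * borel R N)%type -> \bar R} |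
    [/\ g (~` (A `*` A)) = 0,
        g [set (0%R, 0%R)] = 0,
        forall S : set (borel R N), measurable S ->
          S `<=` A `\ 0%R -> pushforward g fst S = nu1 S &
        forall S : set (borel R N), measurable S ->
          S `<=` A `\ 0%R -> pushforward g snd S = nu2 S]].

Definition wasserstein (p : R) nu1 nu2 (r : R) : \bar R :=
  let Br := eball (0%R : 'rV[R]_N) r in
  ereal_inf [set \int[g]_(z in Br `*` Br)
                   (enorm ((z.1 : 'rV[R]_N) - (z.2 : 'rV[R]_N)) `^ p)%R%:E
            | g in admissible Br nu1 nu2] `^ p^-1.

End Wasserstein.

Section Equation.
Context {R : realType} {N : nat}.
Local Notation E := 'rV[R]_N.
Implicit Types (nu : E -> {measure set (borel R N) -> \bar R}) (H : E -> E -> R).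

Definition levy_bounded nu : Prop :=
  exists2 C : R, 0 < C &
    (ereal_sup [set \int[nu xi]_z (levy_weight z)%:E | xi in [set: E]]
       <= C%:E)%E.

Definition levy_tight nu : Prop :=
  ereal_sup [set nu xi (~` eball 0 rho) | xi in [set: E]]
    @[rho --> +oo%R] --> 0%E.

Definition tv_continuous nu (nuL : forall xi, levy_measure (nu xi)) : Prop :=
  forall (r s : R) (r_gt0 : 0 < r), r < s ->
    exists2 omega : R -> R, modulus omega &
      forall x y : E,
        (total_variation (measurable_annulus r s)
           (levy_annulus_fin s (nuL x) r_gt0)
           (levy_annulus_fin s (nuL y) r_gt0) (annulus r s)
         <= (omega (enorm (x - y)))%:E)%E.

Definition wasserstein_holder nu : Prop :=
  exists (r0 : R) (o : R -> R),
    [/\ 0 < r0 < 1,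
        forall r, 0 < r < r0 -> 0 <= o r,
        o r @[r --> 0^'+] --> (0 : R) &
        forall r, 0 < r < r0 -> forall x y : E,
          (wasserstein 2 (nu x) (nu y) r
             <= (o r * enorm (x - y) `^ 2^-1)%:E)%E].

Definition hamiltonian_continuity (m : R) H : Prop :=
  exists omega1 omega2 : R -> R,
    [/\ modulus omega1, modulus omega2 &
        forall x y p q : E, enorm q <= 1 ->
          H y (p + q) - H x p <=
            omega1 (enorm (x - y)) * (1 + enorm p `^ m) +
            omega2 (enorm q) * (1 + enorm p `^ (m - 1))].

Definition hamiltonian_superlinear (m : R) H : Prop :=
  exists bm b0 rho0 mu0 : R,
    [/\ 0 < bm, 0 < b0, 0 < rho0, 0 < mu0 < 1 &
        forall mu (x p : E), mu0 <= mu <= 1 -> rho0 <= enorm p ->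
          mu * H x (mu^-1 *: p) - H x p >= (1 - mu) * (bm * enorm p `^ m - b0)].

(* I[A](x, p, phi), integrated against nu x. *)
Definition nonlocal nu (A : set E) (x p : E) (phi : E -> R) : R :=
  \int[nu x]_(z in A)
    (phi (x + z) - phi x - \1_(eball 0 1) (z : E) * dot p z).

(* The left-hand side of the equation at x, with phi used on B_delta and u
   outside B_delta. *)
Definition visc_op (lambda : R) nu H (delta : R) (phi u : E -> R) (x : E) : R :=
  lambda * u x - nonlocal nu (eball 0 delta) x (grad phi x) phi
    - nonlocal nu (~` eball 0 delta) x (grad phi x) u + H x (grad phi x).

Definition viscosity_subsolution (lambda : R) nu H (u : E -> R) : Prop :=
  [/\ upper_semicontinuous u, Linfty u &
      forall (x : E) (delta : R) (phi : E -> R), 0 < delta ->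
        C2_on (eball x 1) phi -> Linfty phi ->
        (forall y, eball x delta y -> u y - phi y <= u x - phi x) ->
        visc_op lambda nu H delta phi u x <= 0].

Definition viscosity_supersolution (lambda : R) nu H (v : E -> R) : Prop :=
  [/\ lower_semicontinuous (EFin \o v), Linfty v &
      forall (x : E) (delta : R) (phi : E -> R), 0 < delta ->
        C2_on (eball x 1) phi -> Linfty phi ->
        (forall y, eball x delta y -> v x - phi x <= v y - phi y) ->
        visc_op lambda nu H delta phi v x >= 0].

End Equation.

(* Main.v *)
Require Import Defs.
From mathcomp Require Import ring lra.

(** Doubling of variables. For [t < 1] close to 1, maximize
    [t u(x) - v(y) - k |x - y|^2 - b |x - x0|^2], where [x0] almost maximizes the
    expression without its last term; at the maximum [(X, Y)] put
    [p = 2k (X - Y)] and [q = 2b (X - x0)]. Superlinearity of [H] yields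
    [t H(X, (p + q)/t) - H(Y, p) >= c |p| - eta] with some [c > 0]. In a small
    ball [B_r] the nonlocal terms are compared through a coupling of [nu_X] and
    [nu_Y], which costs [2k W_2^2 <= 2k o(r)^2 |X - Y| = o(r)^2 |p|]; in an annulus
    the total variation costs [(2M + |p|) omega(|X - Y|)]; the rest is small by
    tightness. The costs proportional to [|p|] are absorbed by [c |p|]. *)

(** The obstacle is that [p] has no a priori bound. Boundedness of the solutions only controls
    [k |X - Y|^2], so [|p|] may grow like the square root of [k], and an error that is small
    relative to [|p|] need not be small. Only the factor [t < 1] produces a gain in [|p|], and this
    gain degenerates as [t] tends to 1. Hence no limit is taken: each parameter is fixed once, after
    those it depends on. First comes [t], which determines [c]; then the radius [r] of the coupled
    region and the tail radius [rho]; then a length [L] below which [|X - Y|] has to stay, which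
    determines [k]; then [b]. The slack in the coupling and the radius [delta] of the viscosity test
    are chosen last, when [X] and [Y] are known. The exponent 1/2 in the Wasserstein condition is
    what makes the squared cost linear in [|X - Y|], hence comparable with [|p|] after
    multiplication by [2k]. A further difficulty is that the test function replaces the solution
    inside [B_delta], while a coupling may pair a jump inside this ball with one outside it; the
    resulting error vanishes with [delta] for fixed [k]. *)

Set Implicit Arguments.
Unset Strict Implicit.
Unset Printing Implicit Defensive.

(** * Euclidean structure *)

Section Euclid.
Context {R : realType} {N : nat}.
Implicit Types (x y z p q : 'rV[R]_N) (a b r : R).

Lemma dotC x y : dot x y = dot y x.
Proof. by apply: eq_bigr => i _; rewrite mulrC. Qed.

Lemma dotDl x y z : dot (x + y) z = dot x z + dot y z.
Proof. by rewrite /dot -big_split/=; apply: eq_bigr => i _; rewrite mxE mulrDl. Qed.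

Lemma dotZl a x y : dot (a *: x) y = a * dot x y.
Proof. by rewrite /dot mulr_sumr; apply: eq_bigr => i _; rewrite mxE mulrA. Qed.

Lemma dotNl x y : dot (- x) y = - dot x y.
Proof. by rewrite -scaleN1r dotZl mulN1r. Qed.

Lemma dotDr x y z : dot z (x + y) = dot z x + dot z y.
Proof. by rewrite dotC dotDl !(dotC z). Qed.

Lemma dotNr x y : dot y (- x) = - dot y x.
Proof. by rewrite dotC dotNl dotC. Qed.

Lemma dotBr x y z : dot z (x - y) = dot z x - dot z y.
Proof. by rewrite dotDr dotNr. Qed.

Lemma dotZr a x y : dot y (a *: x) = a * dot y x.
Proof. by rewrite dotC dotZl dotC. Qed.

Lemma dot0r x : dot x 0 = 0.
Proof. by rewrite /dot big1 // => i _; rewrite mxE mulr0. Qed.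

Lemma dotxx_ge0 x : 0 <= dot x x.
Proof. by apply: sumr_ge0 => i _; rewrite -expr2 sqr_ge0. Qed.

Lemma enorm_ge0 x : 0 <= enorm x. Proof. exact: sqrtr_ge0. Qed.

Lemma sqr_enorm x : enorm x ^+ 2 = dot x x.
Proof. by rewrite sqr_sqrtr ?dotxx_ge0. Qed.

Lemma enorm0 : enorm (0 : 'rV[R]_N) = 0.
Proof. by rewrite /enorm dot0r sqrtr0. Qed.

Lemma enormN x : enorm (- x) = enorm x.
Proof. by rewrite /enorm dotNl dotNr opprK. Qed.

Lemma enormB x y : enorm (x - y) = enorm (y - x).
Proof. by rewrite -enormN opprB. Qed.

Lemma enormZ a x : enorm (a *: x) = `|a| * enorm x.
Proof.
by rewrite /enorm dotZl dotZr mulrA -expr2 sqrtrM ?sqr_ge0// sqrtr_sqr.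
Qed.

(** Cauchy-Schwarz, from the nonnegativity of the polynomial [t -> |x + t y|^2] at a suitable
    [t]. *)
Lemma dot_le x y : `|dot x y| <= enorm x * enorm y.
Proof.
have hx := enorm_ge0 x; have hy := enorm_ge0 y.
have K : dot x y ^+ 2 <= (enorm x * enorm y) ^+ 2.
  have Q t : 0 <= dot x x + 2 * t * dot x y + t ^+ 2 * dot y y.
    have := dotxx_ge0 (x + t *: y).
    by rewrite dotDl !dotDr !dotZl !dotZr (dotC y x) => h; nra.
  rewrite exprMn !sqr_enorm.
  have := dotxx_ge0 y; rewrite le_eqVlt => /predU1P[y0|y0].
    have [->|xy0] := eqVneq (dot x y) 0; first by rewrite -y0 expr0n mulr0.
    (* With [dot y y = 0] the polynomial is affine in [t], and this [t] would give it the value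
       -1. *)
    have := Q (- (dot x x + 1) / (2 * dot x y)); rewrite -y0 mulr0 addr0.
    rewrite (_ : 2 * _ * _ = - (dot x x + 1)); first lra.
    by field; exact: xy0.
  have := Q (- dot x y / dot y y).
  rewrite -(ler_pM2r y0) mul0r => /le_trans; rewrite -subr_ge0.
  have -> : (dot x x + 2 * (- dot x y / dot y y) * dot x y +
     (- dot x y / dot y y) ^+ 2 * dot y y) * dot y y =
     dot x x * dot y y - dot x y ^+ 2.
    by field; rewrite gt_eqF.
  by move=> /(_ _ (lexx _)); rewrite subr_ge0.
by rewrite -(ler_sqr (x := `|_|)) ?nnegrE ?mulr_ge0// real_normK ?num_real.
Qed.

Lemma enormD x y : enorm (x + y) <= enorm x + enorm y.
Proof.
have hx := enorm_ge0 x; have hy := enorm_ge0 y.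
rewrite -ler_sqr ?nnegrE ?addr_ge0 ?enorm_ge0// sqr_enorm dotDl !dotDr (dotC y x).
rewrite -!sqr_enorm; have := dot_le x y; rewrite ler_norml => /andP[_]; nra.
Qed.

Lemma coord_le_enorm x i : `|x ord0 i| <= enorm x.
Proof.
rewrite -ler_sqr ?nnegrE ?enorm_ge0// sqr_enorm real_normK ?num_real// /dot.
by rewrite (bigD1 i)//= expr2 lerDl sumr_ge0// => j _; rewrite -expr2 sqr_ge0.
Qed.

Lemma enorm_eq0 x : enorm x = 0 -> x = 0.
Proof.
move=> x0; apply/rowP => i; rewrite mxE; apply/eqP; rewrite -normr_le0.
by rewrite -x0 coord_le_enorm.
Qed.

Lemma eball0P x r : eball 0 r x <-> enorm x < r.
Proof. by rewrite /eball /= subr0. Qed.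

Lemma eball_center x r : 0 < r -> eball x r x.
Proof. by rewrite /eball/= subrr enorm0. Qed.

Lemma continuous_dot p : continuous (dot p).
Proof.
have K : continuous (fun x : 'rV[R]_N => \sum_(i < N) p ord0 i * x ord0 i).
  apply: (@continuous_big _ _ +%R 0%R) => [y|i _ z]; first exact: add_continuous.
  by apply: (@cvgM _ _ (nbhs z)); [exact: cvg_cst|exact: (@coord_continuous R 1 N ord0 i z)].
exact: K.
Qed.

Lemma open_eball x r : open (eball x r).
Proof.
rewrite (_ : eball x r = (fun y => enorm (y - x)) @^-1` `]-oo, r[%classic); last first.
  by apply/seteqP; split => y; rewrite /eball/= in_itv.
apply: open_comp; last exact: interval_open.
move=> y _; apply: (@continuous_comp _ _ _ (fun y => y - x)); last exact: continuous_enorm.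
by apply: (@cvgB _ _ _ (nbhs y)); [exact: cvg_id|exact: cvg_cst].
Qed.

Lemma compact_enorm_le r : compact [set x : 'rV[R]_N | enorm x <= r].
Proof.
have C : compact [set x : 'rV[R]_N | forall i, `[- r, r]%classic (x ord0 i)].
  apply: (@rV_compact R N (fun=> `[- r, r]%classic)) => i.
  exact: segment_compact.
apply: subclosed_compact C _ => [|x /= xr i].
  rewrite (_ : mkset _ = enorm @^-1` `]-oo, r]%classic); last first.
    by apply/seteqP; split => y /=; rewrite in_itv.
  apply: preimage_closed; last exact: interval_closed.
  by move=> y _; exact: continuous_enorm.
by rewrite /= in_itv/= -ler_norml; exact: le_trans (coord_le_enorm x i) xr.
Qed.

Lemma borel_measurable (f : 'rV[R]_N -> R) :
  continuous f -> measurable_fun [set: borel R N] (f : borel R N -> R).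
Proof.
move=> cf; apply: (measurability _ (RGenOpens.measurableE R)).
move=> _ [_ [a [b ->] <-]]; rewrite setTI; apply: sub_sigma_algebra.
by move/continuousP : cf; apply; exact: interval_open.
Qed.

Lemma borel_measurable_shift (f : 'rV[R]_N -> R) x :
  measurable_fun [set: borel R N] (f : borel R N -> R) ->
  measurable_fun [set: borel R N] ((fun z => f (x + z)) : borel R N -> R).
Proof.
move=> mf; have mg : measurable_fun [set: borel R N]
    ((fun z : 'rV[R]_N => x + z) : borel R N -> borel R N).
  apply: (@measurability _ _ (borel R N) (borel R N) _ _ (@open 'rV[R]_N)) => //.
  move=> _ [A oA <-]; rewrite setTI; apply: sub_sigma_algebra.
  have : continuous (fun z : 'rV[R]_N => x + z).
    by move=> z; apply: (@cvgD _ _ _ (nbhs z)); [exact: cvg_cst|exact: cvg_id].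
  by move/continuousP; apply.
exact: (measurableT_comp mf mg).
Qed.

End Euclid.

(** * The Hamiltonian *)

Section Hamiltonian.
Context {R : realType} {N : nat}.
Local Notation E := 'rV[R]_N.

Lemma cvg_at_right0_le (f : R -> R) (e : R) : f s @[s --> 0^'+] --> 0 -> 0 < e ->
  exists2 d : R, 0 < d & forall s, 0 < s < d -> f s <= e.
Proof.
move=> /(@cvgr_lt _ _ _ _ _) /(_ e) + e0 => /(_ e0) [d /= d0 dP].
exists d => // s /andP[s0 sd]; apply/ltW/dP => //=.
by rewrite sub0r normrN gtr0_norm.
Qed.

(** Provides the perturbations that avoid the argument 0 of a modulus of continuity; the direction
    [w] witnesses that the space is not a single point. *)
Lemma nbhs_neq (a b w : E) (P : set E) : w != 0 -> nbhs a P ->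
  exists2 a', P a' & a' != b.
Proof.
move=> w0 aP; have [ab|] := eqVneq a b; last first.
  by exists a => //; exact: nbhs_singleton.
have c : (fun t : R => a + t *: w) @ 0^' --> a.
  rewrite -[X in _ --> X]addr0 -(scale0r w); apply: cvg_within_filter.
  apply: (@cvgD _ _ _ (nbhs 0)); first exact: cvg_cst.
  exact: scalel_continuous.
have [t [Pt t0]] : exists t : R, P (a + t *: w) /\ t != 0.
  apply: (@filter_ex _ 0^'); apply: filterI; first exact: c.
  by exists 1 => //= t _.
exists (a + t *: w) => //; rewrite -ab -subr_eq0 addrC addKr.
by rewrite scaler_eq0 negb_or t0 w0.
Qed.

(** The dimension may be 0. Arguments that move along a direction treat this one-point space
    separately. *)
Lemma rV_unit_or_trivial : (exists2 w : E, w != 0 & enorm w = 1) \/ forall x y : E, x = y.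
Proof.
case: (posnP N) => [N0|N0].
  by right => x y; apply/rowP => -[i i0]; exfalso; rewrite N0 in i0.
left; pose i0 := Ordinal N0; exists (delta_mx ord0 i0).
  apply/eqP => /rowP /(_ i0); rewrite !mxE !eqxx => /eqP.
  by rewrite oner_eq0.
rewrite /enorm /dot (bigD1 i0)//= big1 ?addr0 => [|j /negPf ji].
  by rewrite !mxE !eqxx mulr1 sqrtr1.
by rewrite !mxE ji andbF mulr0.
Qed.

Lemma powR_le_max (t m : R) : 0 <= t -> 1 < m -> t <= 1 + t `^ m.
Proof.
move=> t0 m1; have [t1|/ltW t1] := leP t 1; first by rewrite ler_wpDr ?powR_ge0.
rewrite ler_wpDl// -[leLHS]powRr1//; apply: ler_powR => //; exact: ltW.
Qed.

Lemma powR_pred_le (t m : R) : 0 <= t -> 1 < m -> t `^ (m - 1) <= 1 + t `^ m.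
Proof.
move=> t0 m1; have [t1|/ltW t1] := leP t 1.
  have p1 : 1 `^ (m - 1) = 1 :> R by rewrite powR1.
  rewrite ler_wpDr ?powR_ge0// -[leRHS]p1 ge0_ler_powR ?nnegrE//.
  by rewrite subr_ge0 ltW.
by rewrite ler_wpDl//; apply: ler_powR => //; rewrite lerBlDr lerDl.
Qed.

Section props.
Variables (m : R) (H : E -> E -> R).
Hypotheses (cH : continuous (fun xp : E * E => H xp.1 xp.2)) (m1 : 1 < m)
  (H1 : hamiltonian_continuity m H).

(* The moduli of continuity in the hypothesis are uncontrolled at 0, whence the
   approximation of [y] and [q] by points with [x != y] and [q != 0]. *)
Lemma ham_equicontinuous (e : R) : 0 < e -> exists2 d : R, 0 < d &
  forall x y p q, enorm (x - y) < d -> enorm q < d ->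
    H y (p + q) - H x p <= e * (1 + enorm p `^ m).
Proof.
move=> e0; have [om1 [om2 [M1 M2 H12]]] := H1.
have [d1 d10 D1] := cvg_at_right0_le (e := e / 4) M1.2 (divr_gt0 e0 (ltr0n R 4)).
have [d2 d20 D2] := cvg_at_right0_le (e := e / 4) M2.2 (divr_gt0 e0 (ltr0n R 4)).
exists (Num.min 1 (Num.min d1 d2)); first by rewrite !lt_min ltr01 d10.
set d := Num.min _ _.
have K x y p q : x != y -> q != 0 -> enorm (x - y) < d -> enorm q < d ->
    H y (p + q) - H x p <= e * (1 + enorm p `^ m).
  move=> xy q0; rewrite !lt_min => /and3P[_ xy1 _] /and3P[q1 _ q2].
  apply: (le_trans (H12 x y p q (ltW q1))).
  have t0 := powR_ge0 (enorm p) m; have t1 := powR_ge0 (enorm p) (m - 1).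
  have tt := powR_pred_le (enorm_ge0 p) m1.
  have pos (z : E) : z != 0 -> 0 < enorm z.
    move=> /eqP z0; rewrite lt_neqAle enorm_ge0 andbT eq_sym.
    by apply/eqP => /enorm_eq0.
  have o1 : om1 (enorm (x - y)) <= e / 4.
    by apply: D1; rewrite xy1 pos// subr_eq0.
  have o2 : om2 (enorm q) <= e / 4 by apply: D2; rewrite q2 pos.
  have : om1 (enorm (x - y)) * (1 + enorm p `^ m) <= e / 4 * (1 + enorm p `^ m).
    by rewrite ler_wpM2r// addr_ge0.
  have : om2 (enorm q) * (1 + enorm p `^ (m - 1)) <= e / 4 * (2 * (1 + enorm p `^ m)).
    apply: (le_trans (ler_wpM2r _ o2)); first by rewrite addr_ge0.
    by apply: ler_wpM2l; lra.
  set X := om1 _ * _; set Y := om2 _ * _; nra.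
move=> x y p q xy qd; case: rV_unit_or_trivial => [[w w0 _]|triv]; last first.
  rewrite (triv y x) (triv (p + q) p) subrr mulr_ge0 ?addr_ge0 ?powR_ge0//.
  exact: ltW.
(* A violation of the inequality is an open condition in [(y, p + q)] by continuity of [H], so it
   would persist at nearby points with [y' != x] and [q' != 0], where [K] forbids it. *)
rewrite leNgt; apply/negP; rewrite ltrBrDr => lt.
have := @cH (y, p + q); move=> /cvgr_gt /(_ _ lt) [[A B] /= [nA nB] AB].
have [y' [Ay' y'd] y'x] : exists2 y', A y' /\ enorm (x - y') < d & y' != x.
  apply: (@nbhs_neq y x w _ w0); apply: filterI => //.
  have : nbhs y (eball x d).
    by apply: open_nbhs_nbhs; split; [exact: open_eball|rewrite /eball/= enormB].
  by apply: filterS => z; rewrite /eball/= enormB.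
have [q' [Bq' q'd] q'0] : exists2 q', B (p + q') /\ enorm q' < d & q' != 0.
  apply: (@nbhs_neq q 0 w _ w0); apply: filterI.
    have : (fun q' => p + q') @ q --> p + q.
      by apply: (@cvgD _ _ _ (nbhs q)); [exact: cvg_cst|exact: cvg_id].
    exact.
  have : nbhs q (eball 0 d).
    by apply: open_nbhs_nbhs; split; [exact: open_eball|exact/eball0P].
  by apply: filterS => z /eball0P.
have := K x y' p q'; rewrite eq_sym => /(_ y'x q'0 y'd q'd).
rewrite leNgt ltrBrDr => /negP; apply; exact: (AB (y', p + q')).
Qed.

Hypothesis H2 : hamiltonian_superlinear m H.

(** The continuity hypothesis only bounds differences of [H], so uniformity in [x] has to come from
    superlinearity. On the sphere [|p| = rho0], writing [mu H(x, p/mu) - H(x, p) = mu (H(x, p/mu) -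
    H(x, p)) - (1 - mu) H(x, p)] turns the lower bound of the left side into an upper bound of
    [H(x, p)]. Equicontinuity then carries this bound into the ball. *)
Lemma ham_bounded (rho0 bm b0 mu0 : R) : 0 < bm -> 0 < b0 -> 0 < rho0 -> 0 < mu0 < 1 ->
  (forall mu (x p : E), mu0 <= mu <= 1 -> rho0 <= enorm p ->
          mu * H x (mu^-1 *: p) - H x p >= (1 - mu) * (bm * enorm p `^ m - b0)) ->
  exists C : R, forall x p, enorm p <= rho0 -> H x p <= C.
Proof.
move=> bm0 b00 r0 /andP[mu00 mu01] H3.
have [d d0 D] := ham_equicontinuous ltr01.
set K := 1 + rho0 `^ m; have K0 : 0 < K by rewrite ltr_pwDl ?powR_ge0.
(* The last condition places [p/mu] within [d] of [p] when [|p| = rho0]. *)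
have [mu [mu1 muP mu0mu mur]] : exists mu : R, [/\ mu < 1, 0 < mu, mu0 <= mu &
    rho0 <= mu * (rho0 + d / 2)].
  exists (Num.max mu0 (rho0 / (rho0 + d / 2))); split.
  - by rewrite gt_max mu01 /= ltr_pdivrMr ?mul1r ?ltrDl ?divr_gt0 ?addr_gt0 ?divr_gt0.
  - by rewrite lt_max mu00.
  - by rewrite le_max lexx.
  - by rewrite -ler_pdivrMr ?addr_gt0 ?divr_gt0// le_max lexx orbT.
pose C0 := K / (1 - mu) + b0.
have bd x p : enorm p = rho0 -> H x p <= C0.
  move=> pr; have := H3 mu x p; rewrite mu0mu (ltW mu1) pr lexx => /(_ isT isT).
  have := D x x p (mu^-1 *: p - p); rewrite subrr enorm0 => /(_ d0).
  rewrite [p + _]addrC subrK (_ : mu^-1 *: p - p = (mu^-1 - 1) *: p); last first.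
    by rewrite scalerBl scale1r.
  rewrite enormZ pr ger0_norm; last first.
    by rewrite subr_ge0 invf_ge1// ltW.
  have -> : (mu^-1 - 1) * rho0 < d.
    rewrite mulrBl mul1r ltrBlDl mulrC ltr_pdivrMr//.
    by have := mulr_gt0 muP d0; lra.
  move=> /(_ isT); rewrite mul1r -/K => hA hB.
  have r1 : 0 < 1 - mu by rewrite subr_gt0.
  rewrite /C0 -(ler_pM2r r1) mulrDl divfK ?gt_eqF//.
  have sm : 0 <= (1 - mu) * (bm * rho0 `^ m).
    by rewrite mulr_ge0 ?subr_ge0 ?mulr_ge0 ?powR_ge0// ltW.
  have : mu * (H x (mu^-1 *: p) - H x p) <= mu * K by rewrite ler_pM2l.
  have : mu * K <= 1 * K by rewrite ler_pM2r// ltW.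
  lra.
case: rV_unit_or_trivial => [[w w0 w1]|triv]; last first.
  by exists (H 0 0) => x p _; rewrite (triv x 0) (triv p 0).
pose n := (Num.truncn (2 * rho0 / d)).+1.
have n0 : 0 < n%:R :> R by rewrite ltr0n.
have nd : 2 * rho0 / n%:R < d.
  by rewrite ltr_pdivrMr// [d * _]mulrC -ltr_pdivrMr// truncnS_gt.
(* The segment from a point [p'] of the sphere to [p] has length at most [2 rho0]. It is cut into
   [n] pieces shorter than [d]; by convexity it stays in the ball, so each piece raises [H] by at
   most [K]. *)
exists (C0 + n%:R * K) => x p pr.
have [p' p'r] : exists p' : E, enorm p' = rho0.
  by exists (rho0 *: w); rewrite enormZ w1 mulr1 gtr0_norm.
pose pj (j : nat) := p' + (j%:R / n%:R) *: (p - p').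
have pjr j : (j <= n)%N -> enorm (pj j) <= rho0.
  move=> jn; set s : R := j%:R / n%:R.
  have s0 : 0 <= s by rewrite divr_ge0.
  have s1 : s <= 1 by rewrite ler_pdivrMr// mul1r ler_nat.
  have -> : pj j = (1 - s) *: p' + s *: p.
    by rewrite /pj -/s scalerBr scalerBl scale1r [s *: p - _]addrC addrA.
  apply: (le_trans (enormD _ _)); rewrite !enormZ p'r !ger0_norm ?subr_ge0//.
  nra.
suff main j : (j <= n)%N -> H x (pj j) <= C0 + j%:R * K.
  have := main n (leqnn n); rewrite /pj divff ?gt_eqF// scale1r addrC subrK.
  exact.
elim: j => [_|j IH jn]; first by rewrite /pj mul0r scale0r addr0 mul0r addr0 bd.
have := D x x (pj j) (n%:R^-1 *: (p - p')); rewrite subrr enorm0 => /(_ d0).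
have -> : enorm (n%:R^-1 *: (p - p')) < d.
  rewrite enormZ ger0_norm ?invr_ge0//; apply: le_lt_trans nd.
  rewrite mulrC ler_wpM2r ?invr_ge0//; apply: (le_trans (enormD _ _)).
  by rewrite enormN p'r; lra.
have -> : pj j + n%:R^-1 *: (p - p') = pj j.+1.
  by rewrite /pj -addrA -scalerDl -[in RHS]natr1 mulrDl mul1r.
move=> /(_ isT) hA; have := IH (ltnW jn).
have : enorm (pj j) `^ m <= rho0 `^ m.
  rewrite ge0_ler_powR ?nnegrE ?enorm_ge0 ?pjr//; [|exact: ltW|exact: ltnW].
  by apply/ltW; apply: lt_trans m1.
by rewrite -(natr1 j) /K; lra.
Qed.

(** Superlinearity yields a gain of order [(1 - mu) |p + q|^m]. Half of it pays for replacing
    [(x, p + q)] by [(y, p)], and the rest dominates a multiple of [|p|] because [m > 1]. The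
    threshold [mu1] depends on [eta] alone, whereas [c] and [d] depend on [mu]. *)
Lemma ham_lower (eta : R) : 0 < eta -> exists2 mu1 : R, 0 < mu1 < 1 &
  forall mu, mu1 <= mu < 1 -> exists c d : R, [/\ 0 < c, 0 < d &
   forall x y p q, enorm (x - y) < d -> enorm q < d ->
     c * enorm p - eta <= mu * H x (mu^-1 *: (p + q)) - H y p].
Proof.
move=> eta0; have [bm [b0 [rho0 [mu0 [bm0 b00 rho00 mu00 H3]]]]] := H2.
have [C HC] := ham_bounded bm0 b00 rho00 mu00 H3.
have m0 : 0 <= m by apply/ltW; apply: lt_trans m1.
pose K := 1 + (2 * rho0) `^ m.
have K0 : 0 < K by rewrite ltr_pwDl ?powR_ge0.
(* For [|P| <= rho0] and [mu >= 1/2] one has [|P/mu| <= 2 rho0], so [K] bounds the weight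
   [1 + |P/mu|^m]. *)
pose e := eta / (16 * K).
have e0 : 0 < e by rewrite divr_gt0 ?mulr_gt0.
have eK : e * K = eta / 16 by rewrite /e; field; rewrite gt_eqF.
have [d d0 D] := ham_equicontinuous e0.
pose T := b0 + `|C| + bm * rho0 `^ m + 1.
have T0 : 0 < T.
  rewrite ltr_wpDl//; apply: addr_ge0; first by rewrite addr_ge0// ltW.
  by rewrite mulr_ge0 ?powR_ge0// ltW.
have /andP[mu0p mu0l] := mu00.
(* With [1 - mu <= ka]: superlinearity applies, [mu >= 1/2], all terms with the factor [1 - mu]
   (collected in [T]) total at most [eta / 16], and [P/mu] is within [d] of [P] for
   [|P| <= rho0]. *)
pose ka := Num.min (1 - mu0) (Num.min (2^-1) (Num.min (eta / (16 * T)) (d / (4 * rho0)))).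
have ka0 : 0 < ka.
  by rewrite !lt_min subr_gt0 mu0l invr_gt0 ltr0n/= !divr_gt0 ?mulr_gt0.
have [k1 k2 k3 k4] : [/\ ka <= 1 - mu0, ka <= 2^-1, ka <= eta / (16 * T) & ka <= d / (4 * rho0)].
  by rewrite /ka; split; rewrite !ge_min lexx ?orbT.
exists (1 - ka); first by lra.
move=> mu /andP[muk mu1].
have mup : 2^-1 <= mu by lra.
have mugt0 : 0 < mu by lra.
have k3' : (1 - mu) * T <= eta / 16.
  have -> : eta / 16 = eta / (16 * T) * T by field; rewrite gt_eqF.
  by apply: ler_wpM2r; [exact: ltW|lra].
have k4' : (1 - mu) * (4 * rho0) <= d.
  by rewrite -ler_pdivlMr ?mulr_gt0//; lra.
pose c1 := (1 - mu) * bm.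
have c10 : 0 < c1 by rewrite mulr_gt0 ?subr_gt0.
have step1 x P : c1 * enorm P `^ m - eta / 4 <= mu * H x (mu^-1 *: P) - H x P.
  have Cn : 0 <= `|C| by []; have rm := powR_ge0 rho0 m.
  have [Pr|/ltW Pr] := leP rho0 (enorm P).
    apply: le_trans (H3 mu x P _ Pr); last by apply/andP; split; lra.
    rewrite mulrBr /c1 mulrA lerD2l lerN2.
    apply: (le_trans _ (_ : eta / 16 <= _)); last by lra.
    apply: le_trans k3'; apply: ler_wpM2l; first by lra.
    by rewrite /T; have := mulr_ge0 (ltW bm0) rm; lra.
  (* For [|P| < rho0] superlinearity says nothing. The quantity equals [- mu (H x P - H x (P/mu)) -
     (1 - mu) H x P]; equicontinuity based at [P/mu] bounds the first term and [ham_bounded] the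
     second. *)
  have mui : mu^-1 <= 2 by rewrite -[leRHS]invrK lef_pV2 ?posrE ?invr_gt0.
  have mui1 : 1 <= mu^-1 by rewrite invf_ge1// ltW.
  have := D x x (mu^-1 *: P) (P - mu^-1 *: P); rewrite subrr enorm0 => /(_ d0).
  rewrite [_ + (P - _)]addrC subrK (_ : P - mu^-1 *: P = (1 - mu^-1) *: P); last first.
    by rewrite scalerBl scale1r.
  rewrite enormZ ler0_norm ?subr_le0// opprB.
  have -> : (mu^-1 - 1) * enorm P < d.
    apply: (@le_lt_trans _ _ ((mu^-1 - 1) * rho0)).
      by rewrite ler_wpM2l ?subr_ge0.
    have -> : mu^-1 - 1 = (1 - mu) * mu^-1 by field; rewrite gt_eqF.
    by have := mulr_gt0 (mulr_gt0 (_ : 0 < 1 - mu) rho00) (_ : 0 < mu^-1); nra.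
  move=> /(_ isT).
  have pm : enorm (mu^-1 *: P) `^ m <= (2 * rho0) `^ m.
    apply: ge0_ler_powR; rewrite ?nnegrE ?enorm_ge0 ?mulr_ge0 ?(ltW rho00)//.
    rewrite enormZ ger0_norm ?invr_ge0 ?(ltW mugt0)//.
    by apply: ler_pM; rewrite ?invr_ge0 ?enorm_ge0 ?(ltW mugt0).
  have ePm : e * (1 + enorm (mu^-1 *: P) `^ m) <= eta / 16.
    by rewrite -eK; apply: ler_wpM2l; [exact: ltW|rewrite /K lerD2l].
  have pm2 : c1 * enorm P `^ m <= (1 - mu) * (bm * rho0 `^ m).
    rewrite /c1 -mulrA; apply: ler_wpM2l; first by lra.
    apply: ler_wpM2l; first exact: ltW.
    by apply: ge0_ler_powR; rewrite ?nnegrE ?enorm_ge0 ?(ltW rho00).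
  have := HC x P Pr; have Cl := ler_norm C => hC hA.
  have : (1 - mu) * H x P <= (1 - mu) * `|C|.
    by apply: ler_wpM2l; [lra|exact: le_trans Cl].
  have hh : mu * (H x P - H x (mu^-1 *: P)) <= eta / 16.
    have [hle|/ltW hle] := leP (H x P - H x (mu^-1 *: P)) 0; last by nra.
    by nra.
  have sb : (1 - mu) * b0 >= 0 by apply: mulr_ge0; [lra|exact: ltW].
  have sC : (1 - mu) * `|C| >= 0 by apply: mulr_ge0; [lra|].
  have sm : (1 - mu) * (bm * rho0 `^ m) >= 0.
    by apply: mulr_ge0; [lra|apply: mulr_ge0 => //; exact: ltW].
  move: k3'; rewrite /T !mulrDr mulr1; nra.
pose e2 := Num.min (c1 / 2) (eta / 4).
have e20 : 0 < e2 by rewrite lt_min; apply/andP; split; apply: divr_gt0.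
have e2c : e2 <= c1 / 2 by rewrite ge_min lexx.
have e2e : e2 <= eta / 4 by rewrite ge_min lexx orbT.
have [d2 d20 D2] := ham_equicontinuous e20.
exists e2, (Num.min 1 d2); split => //; first by rewrite lt_min ltr01.
move=> x y p q; rewrite !lt_min => /andP[_ xy] /andP[q1 q2].
have := D2 x y (p + q) (- q) xy; rewrite enormN addrK => /(_ q2).
have := step1 x (p + q).
have pP : enorm p <= enorm (p + q) + 1.
  rewrite -{1}(addrK q p); apply: (le_trans (enormD _ _)).
  by rewrite enormN lerD2l ltW.
have tt := powR_le_max (enorm_ge0 (p + q)) m1.
have t0 := powR_ge0 (enorm (p + q)) m.
have : e2 * enorm p <= e2 * (2 + enorm (p + q) `^ m) by apply: ler_wpM2l; lra.
have : e2 * enorm (p + q) `^ m <= c1 / 2 * enorm (p + q) `^ m by rewrite ler_wpM2r.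
nra.
Qed.

End props.
End Hamiltonian.

(** * Doubling of variables *)

(** Compactness enters as a near-covering property, with the level [a] as parameter. Levels tending
    to infinity show that [F] is bounded on [K]; if the supremum were not attained, levels
    increasing to it would yield a smaller upper bound. *)
Lemma usc_compact_max (T : topologicalType) (R : realType) (F : T -> R) (K : set T) :
  compact K -> K !=set0 ->
  (forall x a, K x -> F x < a -> \forall y \near x, F y < a) ->
  exists2 x, K x & forall y, K y -> F y <= F x.
Proof.
move=> /compact_near_coveringP cK [x0 Kx0] usc; apply: contrapT => nmax.
have ub : has_ubound (F @` K).
  have : \forall a \near +oo, K `<=` [set x | F x < a].
    apply: cK => x Kx; have := usc x (F x + 1) Kx; rewrite ltrDl => /(_ ltr01) h.
    exists ([set y | F y < F x + 1], [set a | F x + 1 <= a]) => /=.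
      by split => //; apply: nbhs_pinfty_ge; exact: num_real.
    by move=> [y a] [/= ya xa]; exact: lt_le_trans xa.
  move=> /(@filter_ex _ +oo%R)[a Ka]; exists a => _ [y Ky <-].
  by apply/ltW; exact: Ka.
have Fs x : K x -> F x < sup (F @` K).
  move=> Kx; have le_s y : K y -> F y <= sup (F @` K).
    by move=> Ky; apply: ub_le_sup => //; exists y.
  rewrite lt_neqAle le_s// andbT; apply/eqP => Fx; apply: nmax.
  by exists x => // y Ky; rewrite Fx le_s.
have : \forall a \near (sup (F @` K))^'-, K `<=` [set x | F x < a].
  apply: cK => x Kx; pose c := (F x + sup (F @` K)) / 2.
  have [xc cs] : F x < c /\ c < sup (F @` K) by have := Fs _ Kx; rewrite /c; split; lra.
  exists ([set y | F y < c], [set a | c < a]) => /=.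
    by split; [exact: usc|exact: nbhs_left_gt].
  by move=> [y a] [/= ya xa]; exact: lt_trans xa.
move=> h; have [a [Ka as_]] : exists a, K `<=` [set x | F x < a] /\ a < sup (F @` K).
  by apply: (@filter_ex _ (sup (F @` K))^'-); apply: filterI => //; exact: nbhs_left_lt.
suff : sup (F @` K) <= a by rewrite leNgt as_.
apply: ge_sup; first by exists (F x0), x0.
by move=> _ [y Ky <-]; apply/ltW; exact: Ka.
Qed.

Section Doubling.
Context {R : realType} {N : nat}.
Local Notation E := 'rV[R]_N.
Variables (U V : E -> R) (M b k L : R).
Hypotheses (uscU : upper_semicontinuous U)
  (lscV : forall x a, a < V x -> \forall y \near x, a < V y)
  (UM : forall z, `|U z| <= M) (VM : forall z, `|V z| <= M)
  (b0 : 0 < b) (b1 : b <= 1) (k0 : 0 < k) (L0 : 0 < L) (kL : k * L ^+ 2 = 4 * M + 2).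

Let Phi (z : E * E) : R := U z.1 - V z.2 - k * enorm (z.1 - z.2) ^+ 2.

Lemma usc_penalized (x0 : E) (z : E * E) (a : R) :
  Phi z - b * enorm (z.1 - x0) ^+ 2 < a ->
  \forall w \near z, Phi w - b * enorm (w.1 - x0) ^+ 2 < a.
Proof.
set Q := fun w : E * E => k * enorm (w.1 - w.2) ^+ 2 + b * enorm (w.1 - x0) ^+ 2.
have c1 : (fun w : E * E => w.1) @ z --> z.1 by exact: cvg_fst.
have c2 : (fun w : E * E => w.2) @ z --> z.2 by exact: cvg_snd.
have cQ : Q @ z --> Q z.
  have cn (f : E * E -> E) : f @ z --> f z -> (fun w => enorm (f w) ^+ 2) @ z --> enorm (f z) ^+ 2.
    move=> cf; have ce := continuous_comp cf (@continuous_enorm R N (f z)).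
    by rewrite expr2; under eq_fun do rewrite expr2; apply: (@cvgM _ _ (nbhs z)); exact: ce.
  apply: (@cvgD _ _ _ (nbhs z)); apply: (@cvgM _ _ (nbhs z)); try exact: cvg_cst.
    by apply: (cn (fun w => w.1 - w.2)); exact: (@cvgB _ _ _ (nbhs z)).
  by apply: (cn (fun w => w.1 - x0)); apply: (@cvgB _ _ _ (nbhs z)) => //; exact: cvg_cst.
move=> za; pose s := (a - (Phi z - b * enorm (z.1 - x0) ^+ 2)) / 4.
have s0 : 0 < s by rewrite divr_gt0// subr_gt0.
have hU : \forall w \near z, U w.1 < U z.1 + s.
  have := uscU (x := z.1) (a := U z.1 + s); rewrite ltrDl => /(_ s0).
  by move=> h; exact: (c1 _ h).
have hV : \forall w \near z, V z.2 - s < V w.2.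
  have := lscV (x := z.2) (a := V z.2 - s); rewrite gtrBl => /(_ s0).
  by move=> h; exact: (c2 _ h).
have hQ : \forall w \near z, Q z - s < Q w.
  by move/cvgr_gt : cQ; apply; rewrite gtrBl.
have es : Phi z - b * enorm (z.1 - x0) ^+ 2 + 4 * s = a by rewrite /s; field.
near=> w.
have h1 : U w.1 < U z.1 + s by near: w.
have h2 : V z.2 - s < V w.2 by near: w.
have h3 : Q z - s < Q w by near: w.
by move: es h3; rewrite /Phi /Q; lra.
Unshelve. all: end_near. Qed.

(* The penalization of [x] at an almost maximum point [x0] of [Phi] keeps its
   gradient of order [b], whatever the location of [x0]. *)
Lemma doubling_max : exists x0 X Y : E, [/\ enorm (X - x0) <= 1, enorm (X - Y) < L,
  (forall z, U z - V z - b <= U X - V Y) &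
  forall x y, U x - V y - k * enorm (x - y) ^+ 2 - b * enorm (x - x0) ^+ 2 <=
    U X - V Y - k * enorm (X - Y) ^+ 2 - b * enorm (X - x0) ^+ 2].
Proof.
pose S : set R := range Phi.
have UVM x y : - (2 * M) <= U x - V y <= 2 * M.
  by have := UM x; have := VM y; rewrite !ler_norml => /andP[? ?] /andP[? ?]; lra.
have kn (w : E) : 0 <= k * enorm w ^+ 2 by rewrite mulr_ge0 ?sqr_ge0// ltW.
have bn (w : E) : 0 <= b * enorm w ^+ 2 by rewrite mulr_ge0 ?sqr_ge0// ltW.
have Sub z : Phi z <= 2 * M.
  by have /andP[_ h] := UVM z.1 z.2; have := kn (z.1 - z.2); rewrite /Phi; lra.
have hS : has_sup S.
  by split; [exists (Phi (0, 0)), (0, 0)|exists (2 * M) => _ [z _ <-]].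
have supS z : Phi z <= sup S by apply: ub_le_sup; [case: hS|exists z].
have diag z : U z - V z <= sup S.
  by have := supS (z, z); rewrite /Phi/= subrr enorm0 expr0n mulr0 subr0.
have [_ [[x0 y0] _ <-] xy0] := sup_adherent b0 hS.
pose Psi (z : E * E) : R := Phi z - b * enorm (z.1 - x0) ^+ 2.
have Psi0 : Psi (x0, y0) = Phi (x0, y0) by rewrite /Psi/= subrr enorm0 expr0n mulr0 subr0.
(* Beyond distance 1 from [x0] the penalty exceeds [b], the slack in the choice of [(x0, y0)]. *)
have far z : 1 < enorm (z.1 - x0) -> Psi z < Psi (x0, y0).
  move=> z1; rewrite Psi0; apply: le_lt_trans xy0; rewrite /Psi.
  have : 1 <= enorm (z.1 - x0) ^+ 2 by rewrite exprn_ege1// ltW.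
  by move: (supS z) => h1 h2; have := ler_wpM2l (ltW b0) h2; lra.
have kL2 (w : E) : L <= enorm w -> 4 * M + 2 <= k * enorm w ^+ 2.
  move=> Lw; rewrite -kL; apply: ler_wpM2l; first exact: ltW.
  by rewrite ler_sqr ?nnegrE ?enorm_ge0// ltW.
(* At separation [L] the penalty [4M + 2] brings [Psi] down to [-2M - 2] at most, while
   [Psi (x0, y0)] exceeds the diagonal value at [x0] minus [b], hence [-2M - 1]. *)
have close z : Psi (x0, y0) <= Psi z -> enorm (z.1 - z.2) < L.
  move=> zP; rewrite ltNge; apply/negP => /kL2 h.
  have /andP[_ h1] := UVM z.1 z.2; have h2 := diag x0; have /andP[h3 _] := UVM x0 x0.
  have h4 := bn (z.1 - x0).
  have h5 : Psi z <= - (2 * M) - 2 by rewrite /Psi /Phi; lra.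
  rewrite Psi0 in zP; have h6 := lt_le_trans xy0 (le_trans zP h5).
  have : (1 : R) <= 0 by have := b1; lra.
  by rewrite ler10.
pose r1 := enorm x0 + 1; pose r2 := r1 + L.
pose K : set (E * E) := [set x | enorm x <= r1] `*` [set y | enorm y <= r2].
have inK z : Psi (x0, y0) <= Psi z -> K z.
  move=> zP; have zL := close _ zP.
  have z1 : enorm (z.1 - x0) <= 1.
    by rewrite leNgt; apply/negP => /far; rewrite ltNge zP.
  have zr1 : enorm z.1 <= r1.
    rewrite -(subrK x0 z.1) (le_trans (enormD _ _))// /r1 addrC lerD2l.
    exact: z1.
  split=> //=; rewrite -(subrK z.1 z.2) (le_trans (enormD _ _))// /r2 addrC lerD//.
  by rewrite enormB ltW.
have cK : compact K by apply: compact_setX; exact: compact_enorm_le.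
have K0 : K !=set0 by exists (x0, y0); exact: inK.
have [[X Y] _ XYmax] := @usc_compact_max (E * E)%type R Psi K cK K0 (fun z a _ => @usc_penalized x0 z a).
have XY0 : Psi (x0, y0) <= Psi (X, Y) by apply: XYmax; exact: inK.
exists x0, X, Y; split.
- by rewrite leNgt; apply/negP => /(far (X, Y)); rewrite ltNge XY0.
- exact: close XY0.
- move=> z; have := diag z; have := kn (X - Y); have := bn (X - x0).
  by move: XY0 xy0; rewrite Psi0 /Psi /Phi/=; lra.
- move=> x y; have [xyP|xyP] := leP (Psi (x0, y0)) (Psi (x, y)).
    exact: (XYmax (x, y) (inK _ xyP)).
  exact: le_trans (ltW xyP) XY0.
Qed.

End Doubling.

(** * Quadratic test functions *)

Section TestFunctions.
Context {R : realType} {N : nat}.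
Local Notation E := 'rV[R]_N.

(** An exact expansion in [h] makes the difference quotient [l + h K], so no remainder has to be
    estimated. *)
Lemma is_derive_quadratic (f : E -> R) (a v : E) (l K : R) :
  (forall h : R, f (h *: v + a) - f a = h * l + h ^+ 2 * K) -> is_derive a v f l.
Proof.
move=> fE.
have c : (fun h : R => h^-1 *: (f (h *: v + a) - f a)) @ 0^' --> l.
  have c0 : (fun h : R => l + h * K) @ 0^' --> l.
    rewrite -[X in _ --> X]addr0 -[X in _ + X](mul0r K); apply: cvg_within_filter.
    apply: (@cvgD _ _ _ (nbhs 0)); first exact: cvg_cst.
    by apply: (@cvgM _ _ (nbhs 0)); [exact: cvg_id|exact: cvg_cst].
  apply: cvg_trans c0; apply: near_eq_cvg; exists 1 => //= h _ h0.
  by rewrite fE /GRing.scale/=; field.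
by split; [apply/cvg_ex; exists l|exact: cvg_lim c].
Qed.

Lemma near_eq_continuous (f g : E -> R) (x : E) :
  (\forall y \near x, f y = g y) -> {for x, continuous f} -> {for x, continuous g}.
Proof.
move=> fg cf; rewrite /prop_for /continuous_at -(nbhs_singleton fg).
by apply: cvg_trans cf; apply: (@near_eq_cvg _ _ (nbhs x)); apply: filterS fg => y ->.
Qed.

Definition quad (c P : E) (k : R) (x : E) : R :=
  dot P (x - c) + k * dot (x - c) (x - c).

(* Test functions have to be bounded, whence the cut-off. *)
Definition cut_quad (c P : E) (k : R) (x : E) : R :=
  \1_(eball c 1) x * quad c P k x.

Lemma is_derive_quad (c P : E) k x v :
  is_derive x v (quad c P k) (dot P v + 2 * k * dot (x - c) v).
Proof.
apply: (is_derive_quadratic (K := k * dot v v)) => h.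
rewrite /quad (_ : h *: v + x - c = h *: v + (x - c)) ?addrA//.
rewrite !dotDr !dotDl !dotZl !dotZr (dotC v x) (dotC v (- c)).
ring.
Qed.

Lemma continuous_quad (c P : E) k : continuous (quad c P k).
Proof.
have cB (x : E) : (fun y : E => y - c) @ x --> x - c.
  by apply: (@cvgB _ _ _ (nbhs x)); [exact: cvg_id|exact: cvg_cst].
move=> x; apply: (@cvgD _ _ _ (nbhs x)).
  exact: (continuous_comp (cB x) (@continuous_dot _ _ P (x - c))).
apply: (@cvgM _ _ (nbhs x)); first exact: cvg_cst.
have cn : (fun y => enorm (y - c) ^+ 2) @ x --> enorm (x - c) ^+ 2.
  have := continuous_comp (cB x) (@continuous_enorm _ _ (x - c)) => h.
  by rewrite expr2; under eq_fun do rewrite expr2; apply: (@cvgM _ _ (nbhs x)); exact: h.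
rewrite sqr_enorm in cn; apply: cvg_trans cn.
by under eq_fun do rewrite -sqr_enorm.
Qed.

Lemma cut_quadE (c P : E) k x : eball c 1 x -> cut_quad c P k x = quad c P k x.
Proof. by move=> cx; rewrite /cut_quad indicE mem_set// mul1r. Qed.

Lemma near_cut_quad (c P : E) k x : eball c 1 x ->
  \forall y \near x, quad c P k y = cut_quad c P k y.
Proof.
move=> cx; have : nbhs x (eball c 1) by apply: open_nbhs_nbhs; split=> //; exact: open_eball.
by apply: filterS => y cy; rewrite cut_quadE.
Qed.

Lemma derive_cut_quad (c P : E) k x v : eball c 1 x ->
  is_derive x v (cut_quad c P k) (dot P v + 2 * k * dot (x - c) v).
Proof.
by move=> cx; apply: near_eq_is_derive (is_derive_quad c P k x v); exact: near_cut_quad.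
Qed.

Lemma near_derive_cut_quad (c P : E) k x v : eball c 1 x ->
  \forall y \near x, dot P v + 2 * k * dot (y - c) v = 'D_v (cut_quad c P k) y.
Proof.
move=> cx; have : nbhs x (eball c 1) by apply: open_nbhs_nbhs; split=> //; exact: open_eball.
by apply: filterS => y /(derive_cut_quad P k v) [_ ->].
Qed.

(** On the open unit ball the cut-off is locally constant, so derivatives are those of [quad]. The
    equalities are kept on neighbourhoods, since the first one is differentiated again. *)
Lemma C2_cut_quad (c P : E) k : C2_on (eball c 1) (cut_quad c P k).
Proof.
move=> x cx; split.
  by apply: (near_eq_continuous (near_cut_quad P k cx)); exact: continuous_quad.
move=> i /=; set e := delta_mx ord0 i.
have nD := near_derive_cut_quad P k e cx.
pose g y := dot P e + 2 * k * dot (y - c) e.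
(* The first derivative is affine, hence itself a [quad] up to constants, and its continuity is that
   of [quad]. *)
have gQ : g = (fun y => dot P e + 2 * k * quad c e 0 y).
  by apply/funext => y; rewrite /g /quad mul0r addr0 (dotC e).
have Dg v y : is_derive y v g (2 * k * dot v e).
  apply: (is_derive_quadratic (K := 0)) => h.
  by rewrite /g (_ : h *: v + y - c = h *: v + (y - c)) ?addrA// !dotDl !dotZl; ring.
have nD2 v : \forall y \near x, 2 * k * dot v e = 'D_v ('D_e (cut_quad c P k)) y.
  have := near_join nD; apply: filterS => y ny.
  by have [_ <-] := near_eq_is_derive ny (Dg v y).
split.
- by have [] := derive_cut_quad P k e cx.
- apply: (near_eq_continuous (f := g)) => //; rewrite gQ.
  apply: (@cvgD _ _ _ (nbhs x)); first exact: cvg_cst.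
  by apply: (@cvgM _ _ (nbhs x)); [exact: cvg_cst|exact: continuous_quad].
- move=> j; set e' := delta_mx ord0 j; split.
    by have [] := near_eq_is_derive nD (Dg e' x).
  apply: (@near_eq_continuous (fun=> 2 * k * dot e' e)); first exact: nD2.
  exact: cst_continuous.
Qed.

Lemma grad_cut_quad (c P : E) k : grad (cut_quad c P k) c = P.
Proof.
apply/rowP => i; rewrite mxE.
have [_ ->] := derive_cut_quad P k (delta_mx ord0 i) (eball_center c ltr01).
rewrite subrr (dotC 0) dot0r mulr0 addr0 /dot (bigD1 i)//= big1 ?addr0 => [|j /negPf ji].
  by rewrite !mxE !eqxx mulr1.
by rewrite !mxE ji andbF mulr0.
Qed.

Lemma Linfty_cut_quad (c P : E) k : Linfty (cut_quad c P k).
Proof.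
split.
  have mi : measurable_fun [set: borel R N] (\1_(eball c 1) : borel R N -> R).
    apply: measurable_indic; apply: sub_sigma_algebra; exact: open_eball.
  exact: measurable_funM mi (borel_measurable (@continuous_quad c P k)).
exists (enorm P + `|k|) => x; rewrite /cut_quad indicE.
have [/[dup] xc|xc] := pselect (eball c 1 x); last first.
  by rewrite memNset// mul0r normr0 addr_ge0 ?enorm_ge0.
rewrite mem_set// mul1r /eball/= => /ltW {}xc; apply: (le_trans (ler_normD _ _)).
rewrite lerD//.
  apply: (le_trans (dot_le _ _)).
  by rewrite ler_piMr ?enorm_ge0.
rewrite -sqr_enorm normrM ler_piMr//.
by rewrite normrX ger0_norm ?enorm_ge0// expr_le1 ?enorm_ge0.
Qed.

Section jets.
Variables (lambda : R) (nu : E -> {measure set (borel R N) -> \bar R}) (H : E -> E -> R).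

(** Within the unit ball the compensator removes exactly the linear part of the test function. *)
Lemma nonlocal_cut_quad (c P : E) k delta : delta <= 1 ->
  nonlocal nu (eball 0 delta) c P (cut_quad c P k) =
  \int[nu c]_(z in eball 0 delta) (k * enorm z ^+ 2).
Proof.
move=> d1; apply: eq_Rintegral => z; rewrite inE => /eball0P zd.
have z1 : enorm z < 1 by exact: lt_le_trans d1.
rewrite !cut_quadE; [|exact: eball_center|by rewrite /eball/= addrC addKr].
have cz : c + z - c = z by rewrite addrC addKr.
rewrite /quad subrr !dot0r cz mulr0 !addr0 subr0 indicE mem_set; last exact/eball0P.
by rewrite mul1r addrC addKr sqr_enorm.
Qed.

(** With [delta <= 1] the test ball lies where the cut-off equals 1, so touching from above by the
    test function is the stated quadratic inequality. Test functions do not appear after this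
    point. *)
Lemma subsolution_jet u c P k delta : viscosity_subsolution lambda nu H u ->
  0 < delta <= 1 ->
  (forall z, enorm z < delta -> u (c + z) <= u c + dot P z + k * enorm z ^+ 2) ->
  lambda * u c - \int[nu c]_(z in eball 0 delta) (k * enorm z ^+ 2)
    - nonlocal nu (~` eball 0 delta) c P u + H c P <= 0.
Proof.
move=> [_ _ /(_ c delta (cut_quad c P k))] + /andP[d0 d1] uP => /(_ d0).
move=> /(_ (C2_cut_quad P k) (Linfty_cut_quad c P k)).
rewrite /visc_op grad_cut_quad nonlocal_cut_quad//; apply.
move=> y yd; have yc : eball c 1 y by exact: lt_le_trans d1.
rewrite (cut_quadE P k yc) (cut_quadE P k (eball_center c ltr01)).
have := uP (y - c) yd; rewrite [c + _]addrC subrK sqr_enorm.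
by rewrite /quad subrr !dot0r; lra.
Qed.

Lemma supersolution_jet v c P k delta : viscosity_supersolution lambda nu H v ->
  0 < delta <= 1 ->
  (forall z, enorm z < delta -> v c + dot P z + k * enorm z ^+ 2 <= v (c + z)) ->
  0 <= lambda * v c - \int[nu c]_(z in eball 0 delta) (k * enorm z ^+ 2)
    - nonlocal nu (~` eball 0 delta) c P v + H c P.
Proof.
move=> [_ _ /(_ c delta (cut_quad c P k))] + /andP[d0 d1] vP => /(_ d0).
move=> /(_ (C2_cut_quad P k) (Linfty_cut_quad c P k)).
rewrite /visc_op grad_cut_quad nonlocal_cut_quad//; apply.
move=> y yd; have yc : eball c 1 y by exact: lt_le_trans d1.
rewrite (cut_quadE P k yc) (cut_quadE P k (eball_center c ltr01)).
have := vP (y - c) yd; rewrite [c + _]addrC subrK sqr_enorm.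
by rewrite /quad subrr !dot0r; lra.
Qed.

End jets.
End TestFunctions.

(** * Integrals against couplings and total variation *)

Section Marginal.
Local Open Scope ereal_scope.
Context {R : realType} {N : nat} d (X : measurableType d).
Variables (g : {measure set X -> \bar R}) (nu : {measure set (borel R N) -> \bar R})
  (phi : X -> borel R N) (D : set X) (B : set (borel R N)).
Hypotheses (mphi : measurable_fun [set: X] phi) (mD : measurable D)
  (mB : measurable B) (gD : g (~` D) = 0) (DB : forall z, D z -> B (phi z))
  (gnu : forall S : set (borel R N), measurable S -> S `<=` B `\ 0%R ->
    pushforward g phi S = nu S).

Lemma measurable_borel0 : measurable ([set 0%R] : set (borel R N)).
Proof.
rewrite -[X in measurable X]setCK; apply: measurableC; apply: sub_sigma_algebra.
apply: closed_openC; apply: accessible_closed_set1; apply: hausdorff_accessible.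
exact: norm_hausdorff.
Qed.

(* The marginal may have an atom at the origin, where [f] vanishes. *)
Lemma marginal_integral (f : borel R N -> R) :
  measurable_fun [set: borel R N] f -> f 0%R = 0%R ->
  nu.-integrable B (EFin \o f) ->
  g.-integrable D (EFin \o (f \o phi)) /\
  (\int[g]_(z in D) f (phi z) = \int[nu]_(z in B) f z)%R.
Proof.
move=> mf f0 intf; pose S := B `\ 0%R.
have mS : measurable S by apply: measurableD => //; exact: measurable_borel0.
have mpS : measurable (phi @^-1` S) by rewrite -[X in measurable X]setTI; exact: mphi.
have mEf : measurable_fun [set: borel R N] (EFin \o f) by apply/measurable_EFinP.
have mEfp : measurable_fun [set: X] (EFin \o (f \o phi)).
  by apply/measurable_EFinP; exact: measurableT_comp.
have intS : nu.-integrable S (EFin \o f).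
  by apply: integrableS intf => //; exact: subDsetl.
have fS z : D z -> ~ S (phi z) -> f (phi z) = 0%R.
  move=> Dz nS; have -> // : phi z = 0%R.
  by apply: contrapT => z0; apply: nS; split => //; exact: DB.
have intpS : g.-integrable (phi @^-1` S) (EFin \o (f \o phi)).
  apply/integrableP; split; first exact: measurable_funTS.
  have := ge0_integral_pushforward mphi g (D := S) (f := abse \o (EFin \o f)) mS.
  move=> /(_ _ _) <-; last 2 first.
  - by apply: measurable_funTS; apply: measurableT_comp.
  - by move=> y _; exact: abse_ge0.
  rewrite (eq_measure_integral nu) => [|A mA AS]; last exact: gnu.
  by have /integrableP[] := intS.
have intD : g.-integrable D (EFin \o (f \o phi)).
  apply/integrableP; split; first exact: measurable_funTS.
  have /integrableP[_] := intpS; apply: le_lt_trans.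
  rewrite [leLHS](_ : _ = \int[g]_(z in D `&` phi @^-1` S) `|(EFin \o (f \o phi)) z|).
    apply: ge0_subset_integral => //; first exact: measurableI.
    by apply: measurableT_comp => //; exact: measurable_funTS.
  rewrite integral_mkcondr; apply: eq_integral => z /set_mem Dz.
  rewrite patchE; case: ifPn => // /negP zS /=.
  by rewrite fS ?normr0// => Sz; apply: zS; exact: mem_set.
split=> //; rewrite /Rintegral; congr fine.
(* The domain passes from [D] to the preimage of [S] at no cost: [f] vanishes at the origin, and [g]
   does not charge the complement of [D]. *)
transitivity (\int[g]_(z in D `&` phi @^-1` S) (f (phi z))%:E).
  rewrite integral_mkcondr; apply: eq_integral => z /set_mem Dz.
  rewrite patchE; case: ifPn => // /negP zS /=.
  by rewrite fS// => Sz; apply: zS; exact: mem_set.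
transitivity (\int[g]_(z in phi @^-1` S) (f (phi z))%:E).
  rewrite [RHS](negligible_integral (measurableC mD))//.
  by rewrite setDE setCK setIC.
have <- := integral_pushforward mphi (f := EFin \o f) mEf intpS mS.
transitivity (\int[nu]_(z in S) (f z)%:E).
  by apply: eq_measure_integral => A mA AS; exact: gnu.
rewrite integral_mkcondr; apply: eq_integral => z /set_mem Bz.
by rewrite patchE; case: ifPn => // /negP zS /=; have [->|//] := pselect (z = 0%R); rewrite ?f0//;
  move=> z0; case: zS; apply: mem_set.
Qed.

End Marginal.

Section TotalVariation.
Local Open Scope ereal_scope.
Context d (T : measurableType d) (R : realType).
Variables (mu1 mu2 : {measure set T -> \bar R}) (D : set T) (mD : measurable D)
  (fin1 : mu1 D < +oo) (fin2 : mu2 D < +oo).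

Lemma bounded_integrable (mu : {measure set T -> \bar R}) (A : set T) (f : T -> R) (L : R) :
  measurable A -> mu A < +oo -> measurable_fun A f ->
  (forall x, A x -> (`|f x| <= L)%R) -> mu.-integrable A (EFin \o f).
Proof.
move=> mA Aoo mf fL.
have ic : mu.-integrable A (EFin \o cst `|L|%R).
  apply/integrableP; split; first by apply/measurable_EFinP.
  under eq_integral do rewrite /= normr_id.
  by rewrite integral_cst//  lte_mul_pinfty// lee_fin.
apply: le_integrable ic => //; first exact/measurable_EFinP.
by move=> x Ax /=; rewrite lee_fin normr_id (le_trans (fL _ Ax))// ler_norm.
Qed.

(** The Jordan identity is used as an equality of positive measures, [mu1 + jn = mu2 + jp] on [D],
    and applied to the nonnegative function [f + L <= 2L]. Dropping the [jn] integral costs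
    [2L jp(D)]; removing the shift gives back [L (jp(D) - jn(D))], which leaves [L] times the total
    variation. *)
Lemma tv_Rintegral (f : T -> R) (L t : R) : measurable_fun D f ->
  (forall x, D x -> (`|f x| <= L)%R) -> (0 <= L)%R ->
  total_variation mD fin1 fin2 D <= t%:E ->
  (\int[mu1]_(x in D) f x - \int[mu2]_(x in D) f x <= L * t)%R.
Proof.
move=> mf fL L0; rewrite /total_variation.
set diff := cadd _ _; set PH := cid _; set NH := cid _; set h := svalP NH.
rewrite /charge_variation.
set jp := jordan_pos h; set jn := jordan_neg h => tv.
have E A : measurable A -> A `<=` D -> mu1 A + jn A = mu2 A + jp A.
  move=> mA AD; have dA : diff A = mu1 A - mu2 A by rewrite -[in RHS](setIidl AD).
  have := etrans (esym dA) (jordan_decomp h mA).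
  rewrite /cadd/= /cscale mulN1e => e.
  have {}e : mu1 A - mu2 A = jp A - jn A := e.
  have f1 : mu1 A \is a fin_num.
    by rewrite ge0_fin_numE// (le_lt_trans _ fin1)// le_measure ?inE.
  have f2 : mu2 A \is a fin_num.
    by rewrite ge0_fin_numE// (le_lt_trans _ fin2)// le_measure ?inE.
  have f3 : jp A \is a fin_num by exact: fin_num_measure.
  have f4 : jn A \is a fin_num by exact: fin_num_measure.
  move: e; rewrite -(fineK f1) -(fineK f2) -(fineK f3) -(fineK f4).
  by rewrite -!EFinB -!EFinD => -[] e; congr EFin; lra.
pose k x := (f x + L)%R.
have mk : measurable_fun D k by apply: measurable_funD.
have k0 x : D x -> (0 <= k x)%R.
  by move=> /fL; rewrite /k ler_norml => /andP[+ _]; rewrite -[X in (X <= _)%R]add0r -lerBlDr sub0r.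
have k2 x : D x -> (k x <= L + L)%R.
  by move=> /fL; rewrite /k ler_norml => /andP[_ ?]; rewrite lerD2r.
have jpoo : jp D < +oo by rewrite -ge0_fin_numE//; exact: fin_num_measure.
have jnoo : jn D < +oo by rewrite -ge0_fin_numE//; exact: fin_num_measure.
have int (m : {measure set T -> \bar R}) : m D < +oo -> m.-integrable D (EFin \o k).
  move=> moo; apply: (bounded_integrable (L := (L + L)%R)) => // x Dx.
  by rewrite ger0_norm ?k0 ?k2.
have I : \int[mu1]_(x in D) (k x)%:E + \int[jn]_(x in D) (k x)%:E =
         \int[mu2]_(x in D) (k x)%:E + \int[jp]_(x in D) (k x)%:E.
  rewrite -(ge0_integral_measure_add mu1 jn)//; last exact/measurable_EFinP.
  rewrite -(ge0_integral_measure_add mu2 jp)//; last exact/measurable_EFinP.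
  apply: eq_measure_integral => A mA AD.
  by apply: (etrans (measure_addE _ _ _)); rewrite E//; apply/esym; exact: measure_addE.
have {}I : (\int[mu1]_(x in D) k x + \int[jn]_(x in D) k x =
            \int[mu2]_(x in D) k x + \int[jp]_(x in D) k x)%R.
  by rewrite /Rintegral -!fineD ?I//; apply: integrable_fin_num => //; exact: int.
have kf (m : {measure set T -> \bar R}) : m D < +oo ->
    (\int[m]_(x in D) k x = \int[m]_(x in D) f x + L * fine (m D))%R.
  move=> moo; rewrite -(Rintegral_cst m mD) -RintegralD//.
    exact: (bounded_integrable (L := L)).
  by apply: (bounded_integrable (L := L)) => // x _; rewrite ger0_norm.
have fi m : 0 <= m -> m < +oo -> exists a : R, m = a%:E.
  by case: m => // a _ _; exists a.
have [a1 ea1] := fi _ (measure_ge0 mu1 D) fin1.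
have [a2 ea2] := fi _ (measure_ge0 mu2 D) fin2.
have [b1 eb1] : exists a : R, jn D = a%:E by exact: fi (measure_ge0 jn D) jnoo.
have [b2 eb2] : exists a : R, jp D = a%:E by exact: fi (measure_ge0 jp D) jpoo.
have jn0 : (0 <= \int[jn]_(x in D) k x)%R by exact: Rintegral_ge0.
have jp2 : (\int[jp]_(x in D) k x <= (L + L) * b2)%R.
  have -> : ((L + L) * b2 = \int[jp]_(x in D) (L + L))%R.
    by rewrite Rintegral_cst//; congr (_ * _)%R; rewrite [X in fine X]eb2.
  apply: le_Rintegral => //; first exact: int.
  by apply: (bounded_integrable (L := (L + L)%R)) => // x _; rewrite ger0_norm ?addr_ge0.
have {tv} tv : (b2 + b1 <= t)%R by rewrite -lee_fin EFinD -eb1 -eb2.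
have {}E : (a1 + b1 = a2 + b2)%R.
  by have := E D mD (@subset_refl _ D); rewrite ea1 ea2 eb1 eb2 -!EFinD => -[].
move: I; rewrite (kf mu1)// (kf mu2)// ea1 ea2 /= => I.
have : (L * (b2 + b1) <= L * t)%R by rewrite ler_wpM2l.
have : (L * (a1 + b1) = L * (a2 + b2))%R by rewrite E.
move: (\int[jn]_(_ in _) _)%R (\int[jp]_(_ in _) _)%R jn0 jp2 I => J1 J2 jn0 jp2 I.
lra.
Qed.

End TotalVariation.

(** * Lévy measures *)

Section Levy.
Context {R : realType} {N : nat}.
Local Notation E := 'rV[R]_N.
Implicit Types (nu : {measure set (borel R N) -> \bar R}).

Lemma measurable_levy_weight :
  measurable_fun [set: borel R N] (levy_weight : borel R N -> R).
Proof.
apply: measurable_minr => //; apply: measurable_funX; exact: measurable_enorm.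
Qed.

Lemma levy_weight_ge0 (z : E) : 0 <= levy_weight z.
Proof. by rewrite /levy_weight le_min ler01 sqr_ge0. Qed.

Lemma levy_weight_lt1 (z : E) : enorm z <= 1 -> levy_weight z = enorm z ^+ 2.
Proof.
by move=> z1; rewrite /levy_weight; apply/min_idPr; rewrite exprn_ile1 ?enorm_ge0.
Qed.

Lemma levy_weight_ge (z : E) (r : R) : 0 <= r <= 1 -> r <= enorm z ->
  r ^+ 2 <= levy_weight z.
Proof.
move=> /andP[r0 r1] rz; rewrite /levy_weight le_min exprn_ile1//=.
by rewrite ler_sqr ?nnegrE ?enorm_ge0.
Qed.

Section bounded.
Variables (nu : {measure set (borel R N) -> \bar R}) (C : R).
Hypothesis nuC : (\int[nu]_z (levy_weight z)%:E <= C%:E)%E.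

Lemma levy_weight_integrable (A : set (borel R N)) : measurable A ->
  nu.-integrable A (EFin \o levy_weight).
Proof.
move=> mA; apply: (integrableS measurableT) => //.
apply/integrableP; split; first by apply/measurable_EFinP; exact: measurable_levy_weight.
apply: (@le_lt_trans _ _ C%:E); last exact: ltry.
apply: le_trans nuC; rewrite (@eq_integral _ _ _ nu setT (EFin \o (levy_weight : borel R N -> R)))// => z _.
by rewrite /= ger0_norm ?levy_weight_ge0.
Qed.

Lemma levy_weight_Rintegral (A : set (borel R N)) : measurable A ->
  \int[nu]_(z in A) levy_weight z <= C.
Proof.
move=> mA; rewrite -lee_fin fineK; last first.
  by apply: integrable_fin_num => //; exact: levy_weight_integrable.
apply: le_trans nuC; apply: ge0_subset_integral => //.
  by apply/measurable_EFinP; exact: measurable_levy_weight.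
by move=> z _; rewrite lee_fin levy_weight_ge0.
Qed.

Lemma levy_dominated (f : borel R N -> R) (A : set (borel R N)) (K : R) :
  measurable A -> measurable_fun [set: borel R N] f ->
  (forall z, A z -> `|f z| <= K * levy_weight z) -> nu.-integrable A (EFin \o f).
Proof.
move=> mA mf fK.
have iK : nu.-integrable A (EFin \o (fun z => K * levy_weight z)).
  have := integrableZl mA K (levy_weight_integrable mA).
  by apply: eq_integrable.
apply: le_integrable iK => //; first by apply/measurable_EFinP; exact: measurable_funTS.
by move=> z Az /=; rewrite lee_fin (le_trans (fK _ Az))// ler_norm.
Qed.

(** Markov's inequality for [levy_weight], which is at least [r^2] on [A]. *)
Lemma levy_tail (A : set (borel R N)) (r : R) : measurable A -> 0 < r <= 1 ->
  (forall z, A z -> r <= enorm z) ->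
  (nu A < +oo)%E /\ fine (nu A) * r ^+ 2 <= C.
Proof.
move=> mA /andP[r0 r1] Ar.
have K : ((r ^+ 2)%:E * nu A <= C%:E)%E.
  rewrite -integral_cst//; apply: le_trans nuC.
  apply: (@le_trans _ _ (\int[nu]_(z in A) (levy_weight z)%:E)%E).
    apply: ge0_le_integral => //.
    - by move=> z _; rewrite lee_fin sqr_ge0.
    - by apply/measurable_EFinP/measurable_funTS; exact: measurable_levy_weight.
    - by move=> z Az; rewrite lee_fin levy_weight_ge ?Ar// ltW.
  apply: ge0_subset_integral => //.
    by apply/measurable_EFinP; exact: measurable_levy_weight.
  by move=> z _; rewrite lee_fin levy_weight_ge0.
have r20 : 0 < r ^+ 2 by rewrite exprn_gt0.
have nA0 : (0 <= nu A)%E by exact: measure_ge0.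
case: (nu A) K nA0 => [a K _|K _|//].
  by split; [exact: ltry|rewrite /= mulrC -lee_fin].
by move: K; rewrite gt0_muley ?lte_fin.
Qed.

Lemma sq_integrable (A : set (borel R N)) : measurable A -> A `<=` eball 0 1 ->
  nu.-integrable A (EFin \o (fun z : borel R N => enorm (z : E) ^+ 2)).
Proof.
move=> mA A1; apply: (@levy_dominated _ _ 1) => //.
  by apply: measurable_funX; exact: measurable_enorm.
move=> z /A1 /eball0P /ltW z1.
by rewrite ger0_norm ?sqr_ge0// mul1r levy_weight_lt1.
Qed.

Lemma sq_Rintegral_le (A : set (borel R N)) : measurable A -> A `<=` eball 0 1 ->
  \int[nu]_(z in A) (enorm (z : E) ^+ 2) <= C.
Proof.
move=> mA A1; apply: le_trans (levy_weight_Rintegral mA).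
apply: le_Rintegral => //; [exact: sq_integrable|exact: levy_weight_integrable|].
by move=> z /A1 /eball0P /ltW z1; rewrite levy_weight_lt1.
Qed.

(** Dominated convergence along the balls of radius [1/(n+1)]; at the origin the integrand itself
    vanishes. The radius depends on the measure, which is why [delta] is chosen after the maximum
    point. *)
Lemma small_ball (e : R) : 0 < e -> exists2 d0 : R, 0 < d0 <= 1 &
  forall d : R, 0 < d <= d0 -> \int[nu]_(z in eball 0 d) (enorm (z : E) ^+ 2) <= e.
Proof.
move=> e0.
pose s := fun z : borel R N => enorm (z : E) ^+ 2.
have ms : measurable_fun [set: borel R N] s.
  by apply: measurable_funX; exact: measurable_enorm.
have m1 : measurable (eball 0 1 : set (borel R N)) by exact: measurable_eball0.
pose B n : set (borel R N) := eball 0 (n.+1%:R^-1 : R).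
have mB n : measurable (B n) by exact: measurable_eball0.
pose f n (z : borel R N) := (s z * \1_(B n) z)%:E.
have mf n : measurable_fun (eball 0 1 : set (borel R N)) (f n).
  by apply/measurable_EFinP; apply: measurable_funTS; apply: measurable_funM.
have f0 (z : borel R N) : f n z @[n --> \oo] --> 0%E.
  have [->|z0] := eqVneq z 0.
    by apply: cvg_near_cst; near=> n; rewrite /f /s enorm0 expr0n mul0r.
  have ez : 0 < enorm (z : E).
    rewrite lt_neqAle enorm_ge0 andbT eq_sym; apply/eqP => /enorm_eq0 /eqP.
    by rewrite (negPf z0).
  apply: cvg_near_cst; near=> n.
  rewrite /f indicE memNset ?mulr0//; move/eball0P; apply/negP; rewrite -leNgt.
  by near: n; have := near_infty_natSinv_lt (PosNum ez); apply: filterS => n /ltW.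
have ig : nu.-integrable (eball 0 1 : set (borel R N)) (EFin \o s).
  exact: sq_integrable.
have fs (z : borel R N) n : (`|f n z| <= (s z)%:E)%E.
  rewrite lee_fin /f normrM ger0_norm ?sqr_ge0//.
  by rewrite ler_piMr ?sqr_ge0// indicE; case: (_ \in _); rewrite ?normr1 ?normr0.
have [_ _] := @dominated_convergence _ _ _ nu _ m1 f (fun=> 0%E) (EFin \o s) mf
  (measurable_cst _) (aeW nu (fun z _ => f0 z)) ig (aeW nu (fun z n _ => fs z n)).
rewrite integral0 => /fine_cvg /cvgr_lt /(_ _ e0) [n _ /(_ n (leqnn n)) /= fn].
exists (n.+1%:R^-1); first by rewrite invr_gt0 ltr0n invf_le1//= ler1n.
move=> d /andP[d0 dn].
have dB : eball 0 d `<=` B n by move=> z /eball0P zd; apply/eball0P; exact: lt_le_trans dn.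
have B1 : B n `<=` eball 0 1.
  by move=> z /eball0P zd; apply/eball0P; apply: (lt_le_trans zd); rewrite invf_le1//= ler1n.
apply: le_trans (ltW fn).
rewrite /Rintegral; apply: fine_le.
- apply: integrable_fin_num; first exact: measurable_eball0.
  by apply: sq_integrable; [exact: measurable_eball0|exact: subset_trans B1].
- apply: integrable_fin_num => //; apply: le_integrable ig => // z _.
  by rewrite (le_trans (fs _ _))//= lee_fin ler_norm.
- apply: (@le_trans _ _ (\int[nu]_(z in eball 0 d) f n z)%E).
    rewrite le_eqVlt; apply/orP; left; apply/eqP; apply: eq_integral => z /set_mem zd.
    by rewrite /f indicE mem_set ?mulr1//; exact: dB.
  apply: ge0_subset_integral => //; first exact: measurable_eball0.
    by move=> z _; rewrite lee_fin mulr_ge0 ?sqr_ge0.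
  exact: subset_trans B1.
Unshelve. all: end_near.
Qed.

End bounded.

End Levy.

(** * Difference of the nonlocal terms *)

Section Coupling.
Context {R : realType} {N : nat}.
Local Notation E := 'rV[R]_N.
Implicit Types (nu : {measure set (borel R N) -> \bar R}).

(** Checked coordinatewise, since the sigma-algebra is the product of two Borel ones rather than the
    Borel one of the product. *)
Lemma measurable_sq_dist : measurable_fun [set: (borel R N * borel R N)%type]
  (fun z : borel R N * borel R N => enorm ((z.1 : E) - (z.2 : E)) ^+ 2).
Proof.
under eq_fun do rewrite sqr_enorm.
apply: measurable_sum => i.
have mi : measurable_fun [set: borel R N] ((fun z : E => z ord0 i) : borel R N -> R).
  by apply: borel_measurable => z; exact: coord_continuous.
have m1 : measurable_fun [set: (borel R N * borel R N)%type]
    (fun z : borel R N * borel R N => ((z.1 : E) - (z.2 : E)) ord0 i).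
  under eq_fun do rewrite !mxE.
  apply: measurable_funB.
    exact: (measurableT_comp mi measurable_fst).
  exact: (measurableT_comp mi measurable_snd).
exact: measurable_funM.
Qed.

(** The infimum need not be attained; the slack [e] spares the existence of an optimal coupling. *)
Lemma wasserstein_coupling nu1 nu2 (r X e : R) : 0 <= X -> 0 < e ->
  (wasserstein 2 nu1 nu2 r <= X%:E)%E ->
  exists2 g, admissible (eball 0 r) nu1 nu2 g &
    let f := fun z : borel R N * borel R N => enorm ((z.1 : E) - (z.2 : E)) ^+ 2 in
    g.-integrable (eball 0 r `*` eball 0 r) (EFin \o f) /\
    \int[g]_(z in eball 0 r `*` eball 0 r) f z <= X ^+ 2 + e.
Proof.
move=> X0 e0; rewrite /wasserstein; set S := (X in ereal_inf X).
have I0 : (0 <= ereal_inf S)%E.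
  apply: le_ereal_inf_tmp => _ [g _ <-]; apply: integral_ge0 => z _.
  by rewrite lee_fin powR_ge0.
move=> h; have {h} IX : (ereal_inf S <= (X ^+ 2)%:E)%E.
  have := @gt0_ler_poweR R 2 (ler0n _ 2) _ _ _ _ h.
  rewrite -poweRrM mulVf ?pnatr_eq0// poweRe1// poweR_EFin powR_mulrn//.
  by apply; rewrite in_itv/= ?poweR_ge0 ?lee_fin ?leey ?X0.
have : (ereal_inf S < (X ^+ 2 + e)%:E)%E.
  by apply: (le_lt_trans IX); rewrite lte_fin ltrDl.
move=> /ereal_inf_lt[_ [g gadm <-] gX]; exists g => //=.
set B : set (borel R N * borel R N)%type := eball 0 r `*` eball 0 r.
have mB : measurable B by apply: measurableX; exact: measurable_eball0.
have eI : (\int[g]_(z in B) (enorm ((z.1 : E) - (z.2 : E)) `^ 2)%:E =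
    \int[g]_(z in B) (enorm ((z.1 : E) - (z.2 : E)) ^+ 2)%:E)%E.
  by apply: eq_integral => z _; rewrite powR_mulrn ?enorm_ge0.
rewrite eI in gX.
have ig : g.-integrable B
    (EFin \o (fun z : borel R N * borel R N => enorm ((z.1 : E) - (z.2 : E)) ^+ 2)).
  apply/integrableP; split.
    by apply/measurable_EFinP; apply: measurable_funTS; exact: measurable_sq_dist.
  apply: le_lt_trans (lt_trans gX (ltry _)).
  rewrite le_eqVlt; apply/orP; left; apply/eqP; apply: eq_integral => z _ /=.
  by rewrite ger0_norm ?sqr_ge0.
split=> //; rewrite -lee_fin fineK; first exact: ltW.
by apply: integrable_fin_num.
Qed.

End Coupling.

Section JetFun.
Context {R : realType} {N : nat}.
Local Notation E := 'rV[R]_N.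

(* The integrand of the viscosity inequality at [x]: the quadratic part of the
   test function on the ball of radius [delta], the solution outside. *)
Definition jet_fun (U : E -> R) (x P : E) (kappa delta : R) (z : E) : R :=
  if enorm z < delta then kappa * enorm z ^+ 2
  else U (x + z) - U x - \1_(eball 0 1) z * dot P z.

Variables (U : E -> R) (x P : E) (kappa delta M : R).
Hypotheses (mU : measurable_fun [set: borel R N] (U : borel R N -> R))
  (UM : forall z, `|U z| <= M) (d0 : 0 < delta) (d1 : delta <= 1).

(** Makes [marginal_integral] applicable: a mass that the marginals of a coupling carry at the
    origin is not seen. *)
Lemma jet_fun0 : jet_fun U x P kappa delta 0 = 0.
Proof. by rewrite /jet_fun enorm0 d0 expr0n mulr0. Qed.

Lemma measurable_jet_fun :
  measurable_fun [set: borel R N] (jet_fun U x P kappa delta : borel R N -> R).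
Proof.
apply: measurable_fun_ifT.
- by apply: measurable_fun_ltr => //; exact: measurable_enorm.
- by apply: measurable_funM => //; apply: measurable_funX; exact: measurable_enorm.
- apply: measurable_funB.
    by apply: measurable_funB => //; exact: borel_measurable_shift.
  have mi : measurable_fun [set: borel R N] (\1_(eball 0 1) : borel R N -> R).
    by apply: measurable_indic; exact: measurable_eball0.
  exact: measurable_funM mi (borel_measurable (@continuous_dot _ _ P)).
Qed.

Lemma indic_ball_dot (z : E) : `|\1_(eball 0 1) z * dot P z| <= enorm P.
Proof.
have [z1|z1] := pselect (eball 0 1 z); last first.
  by rewrite indicE memNset// mul0r normr0 enorm_ge0.
rewrite indicE mem_set// mul1r; apply: (le_trans (dot_le _ _)).
by rewrite ler_piMr ?enorm_ge0//; move/eball0P : z1 => /ltW.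
Qed.

Lemma jet_fun_le (z : E) : delta <= enorm z ->
  `|jet_fun U x P kappa delta z| <= 2 * M + enorm P.
Proof.
rewrite /jet_fun ltNge => -> /=.
apply: (le_trans (ler_normB _ _)); rewrite lerD ?indic_ball_dot//.
apply: (le_trans (ler_normB _ _)).
by rewrite mulr_natl mulr2n lerD.
Qed.

Lemma jet_fun_integrable (nu : {measure set (borel R N) -> \bar R}) C (A : set (borel R N)) :
  (\int[nu]_z (levy_weight z)%:E <= C%:E)%E -> measurable A ->
  nu.-integrable A (EFin \o (jet_fun U x P kappa delta : borel R N -> R)).
Proof.
move=> nuC mA; pose K := `|kappa| + (2 * M + enorm P) / delta ^+ 2.
have M0 : 0 <= 2 * M + enorm P.
  by rewrite addr_ge0 ?enorm_ge0// mulr_ge0// (le_trans _ (UM 0)).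
have d20 : 0 < delta ^+ 2 by rewrite exprn_gt0.
have K0 : 0 <= (2 * M + enorm P) / delta ^+ 2 by rewrite divr_ge0// ltW.
apply: (levy_dominated nuC mA (K := K)); first exact: measurable_jet_fun.
move=> z _; have [zd|zd] := ltP (enorm z) delta.
  rewrite /jet_fun zd normrM (ger0_norm (sqr_ge0 _)) levy_weight_lt1.
    by apply: ler_wpM2r; rewrite ?sqr_ge0// /K lerDl.
  by apply: (le_trans (ltW zd)).
apply: (le_trans (jet_fun_le zd)).
have w := levy_weight_ge (introT andP (conj (ltW d0) d1)) zd.
apply: (@le_trans _ _ ((2 * M + enorm P) / delta ^+ 2 * levy_weight z)).
  by rewrite mulrAC ler_pdivlMr// ler_wpM2l.
by apply: ler_wpM2r; rewrite ?levy_weight_ge0// /K lerDr.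
Qed.

(** The viscosity inequality cuts the integral at [delta], the comparison at [r] and [rho]; a single
    integrand over the whole space allows the change of cuts. *)
Lemma jet_fun_split (nu : E -> {measure set (borel R N) -> \bar R}) C :
  (\int[nu x]_z (levy_weight z)%:E <= C%:E)%E ->
  \int[nu x]_(z in eball 0 delta) (kappa * enorm (z : E) ^+ 2) +
    nonlocal nu (~` eball 0 delta) x P U =
  \int[nu x]_z jet_fun U x P kappa delta z.
Proof.
move=> nuC; have mB : measurable (eball 0 delta : set (borel R N)).
  exact: measurable_eball0.
rewrite -(setUv (eball 0 delta : set (borel R N))) Rintegral_setU//; last 3 first.
- exact: measurableC.
- by apply: (jet_fun_integrable nuC); apply: measurableU => //; exact: measurableC.
- by apply/disj_setPS; rewrite setICr.
congr (_ + _); apply: eq_Rintegral => z /set_mem.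
  by move=> /eball0P zd; rewrite /jet_fun zd.
by move=> /= zd; rewrite /jet_fun; case: ifPn => // /eball0P.
Qed.

End JetFun.

Section NonlocalDifference.
Context {R : realType} {N : nat}.
Local Notation E := 'rV[R]_N.
Variables (nux nuy : {measure set (borel R N) -> \bar R}) (C : R).
Hypotheses (nuxC : (\int[nux]_z (levy_weight z)%:E <= C%:E)%E)
  (nuyC : (\int[nuy]_z (levy_weight z)%:E <= C%:E)%E).
Variables (U V : E -> R) (M : R) (x y p q : E) (k b delta r rho : R).
Hypotheses (mU : measurable_fun [set: borel R N] (U : borel R N -> R))
  (mV : measurable_fun [set: borel R N] (V : borel R N -> R))
  (UM : forall z, `|U z| <= M) (VM : forall z, `|V z| <= M)
  (k0 : 0 <= k) (b0 : 0 <= b)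
  (d0 : 0 < delta) (dr : delta <= r) (r1 : r < 1) (rho1 : 1 <= rho).
Hypothesis UVmax : forall z1 z2, U (x + z1) - V (y + z2) <= U x - V y +
  dot p (z1 - z2) + dot q z1 + k * enorm (z1 - z2) ^+ 2 + b * enorm z1 ^+ 2.

Let F1 := jet_fun U x (p + q) (k + b) delta.
Let F2 := jet_fun V y p (- k) delta.

Let d1 : delta <= 1. Proof. exact: le_trans (ltW r1). Qed.

Let iF1 A : measurable A -> nux.-integrable A (EFin \o (F1 : borel R N -> R)).
Proof. by move=> mA; apply: (jet_fun_integrable _ _ _ mU UM d0 d1 nuxC). Qed.

Let iF2 A : measurable A -> nuy.-integrable A (EFin \o (F2 : borel R N -> R)).
Proof. by move=> mA; apply: (jet_fun_integrable _ _ _ mV VM d0 d1 nuyC). Qed.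

Let s (z : E) := enorm z ^+ 2.
Let sd (z : E) := if enorm z < delta then enorm z ^+ 2 else 0.

Let sq_triangle (z1 z2 : E) : s z2 <= 2 * s z1 + 2 * s (z1 - z2).
Proof.
have h : enorm z2 <= enorm z1 + enorm (z1 - z2).
  by rewrite -{1}(subKr z1 z2) (le_trans (enormD _ _))// enormN.
have := enorm_ge0 z1; have := enorm_ge0 z2; have := enorm_ge0 (z1 - z2).
rewrite /s; move: (enorm z1) (enorm z2) (enorm (z1 - z2)) h => a c e h e0 c0 a0.
have : c ^+ 2 <= (a + e) ^+ 2 by rewrite ler_sqr ?nnegrE ?addr_ge0.
have : 0 <= (a - e) ^+ 2 by rewrite sqr_ge0.
rewrite !expr2; lra.
Qed.

(** When both jumps leave [B_delta], this is the maximum property at [(z1, z2)]. When only one does,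
    that property is used with the other jump set to 0, and produces the square of the outer jump;
    [sq_triangle] trades it for the inner jump and the distance between the two, whence the factors
    2 and 3. *)
Lemma jet_fun_difference (z1 z2 : E) : enorm z1 < r -> enorm z2 < r ->
  F1 z1 - F2 z2 <= 2 * k * s (z1 - z2) + (b * s z1 + (3 * k * sd z1 + 3 * k * sd z2)).
Proof.
move=> zr1 zr2.
have i1 : \1_(eball 0 1) z1 = 1 :> R.
  by rewrite indicE mem_set//; apply/eball0P; exact: lt_trans r1.
have i2 : \1_(eball 0 1) z2 = 1 :> R.
  by rewrite indicE mem_set//; apply/eball0P; exact: lt_trans r1.
have s0 z : 0 <= s z by rewrite sqr_ge0.
have t12 := ler_wpM2l k0 (sq_triangle z1 z2).
have t21 := ler_wpM2l k0 (sq_triangle z2 z1).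
have s12 : s (z2 - z1) = s (z1 - z2) by rewrite /s enormB.
rewrite s12 in t21.
have ks1 := mulr_ge0 k0 (s0 z1); have ks2 := mulr_ge0 k0 (s0 z2).
have bs1 := mulr_ge0 b0 (s0 z1); have ks12 := mulr_ge0 k0 (s0 (z1 - z2)).
have m12 := UVmax z1 z2; have m1 := UVmax z1 0; have m2 := UVmax 0 z2.
rewrite !subr0 addr0 -!/(s _) in m1.
rewrite !sub0r addr0 !enormN enorm0 expr0n mulr0 dotNr dot0r -!/(s _) in m2.
rewrite !dotBr -!/(s _) in m12.
rewrite /F1 /F2 /jet_fun /sd i1 i2 !mul1r dotDl -!/(s _).
case: ltP => zd1; case: ltP => zd2; nra.
Qed.

(** The pointwise bound is integrated against the coupling. Each function of a single jump vanishes
    at the origin, so its integral is one against [nux] or [nuy]; only the squared distance remains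
    as a transport cost. *)
Lemma near_part (g : {measure set (borel R N * borel R N)%type -> \bar R}) (W : R) :
  admissible (eball 0 r) nux nuy g ->
  let f := fun z : borel R N * borel R N => enorm ((z.1 : E) - (z.2 : E)) ^+ 2 in
  g.-integrable (eball 0 r `*` eball 0 r) (EFin \o f) ->
  \int[g]_(z in eball 0 r `*` eball 0 r) f z <= W ->
  \int[nux]_(z in eball 0 r) F1 z - \int[nuy]_(z in eball 0 r) F2 z <=
  2 * k * W + (b * C + (3 * k * \int[nux]_(z in eball 0 delta) s z +
                        3 * k * \int[nuy]_(z in eball 0 delta) s z)).
Proof.
move=> [g0 _ g1 g2] f intf fW.
set Br : set (borel R N) := eball 0 r.
set D : set (borel R N * borel R N)%type := Br `*` Br.
have mBr : measurable Br by exact: measurable_eball0.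
have mD : measurable D by exact: measurableX.
have Br1 : Br `<=` eball 0 1.
  by move=> z /eball0P zr; apply/eball0P; exact: lt_trans r1.
have D1 z : D z -> Br z.1 by case.
have D2 z : D z -> Br z.2 by case.
have L1 := marginal_integral measurable_fst mD mBr g0 D1 g1.
have L2 := marginal_integral measurable_snd mD mBr g0 D2 g2.
have ms : measurable_fun [set: borel R N] (s : borel R N -> R).
  by apply: measurable_funX; exact: measurable_enorm.
have msd : measurable_fun [set: borel R N] (sd : borel R N -> R).
  apply: measurable_fun_ifT => //.
  by apply: measurable_fun_ltr => //; exact: measurable_enorm.
have s00 : s 0 = 0 by rewrite /s enorm0 expr0n.
have sd0 : sd 0 = 0 by rewrite /sd enorm0 expr0n; case: ifP.
have isd (nu : {measure set (borel R N) -> \bar R}) : (\int[nu]_z (levy_weight z)%:E <= C%:E)%E ->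
    nu.-integrable Br (EFin \o (sd : borel R N -> R)).
  move=> nuC; apply: le_integrable (sq_integrable nuC mBr Br1) => //.
    by apply/measurable_EFinP; exact: measurable_funTS.
  move=> z _; rewrite lee_fin /sd; case: ifP => // _.
  by rewrite normr0.
have esd (nu : {measure set (borel R N) -> \bar R}) :
    \int[nu]_(z in Br) sd z = \int[nu]_(z in eball 0 delta) s z.
  rewrite Rintegral_mkcond [RHS]Rintegral_mkcond; apply: eq_Rintegral => z _.
  rewrite !patchE; case: ifPn => [_|zr].
    rewrite /sd; case: ifPn => [/eball0P zd|zd]; first by rewrite mem_set.
    by rewrite memNset// => /eball0P; apply/negP.
  rewrite memNset// => /eball0P zd; move/negP: zr; apply; apply: mem_set.
  by apply/eball0P; exact: lt_le_trans dr.
have [iF1g <-] := L1 _ (measurable_jet_fun _ _ _ _ mU) (jet_fun0 _ _ _ _ d0) (iF1 mBr).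
have [iF2g <-] := L2 _ (measurable_jet_fun _ _ _ _ mV) (jet_fun0 _ _ _ _ d0) (iF2 mBr).
have [isg es] := L1 _ ms s00 (sq_integrable nuxC mBr Br1).
have [is1 es1] := L1 _ msd sd0 (isd _ nuxC).
have [is2 es2] := L2 _ msd sd0 (isd _ nuyC).
rewrite -/D -RintegralB//.
pose T1 := fun z : borel R N * borel R N => 2 * k * f z.
pose T2 := fun z : borel R N * borel R N => b * s z.1.
pose T3 := fun z : borel R N * borel R N => 3 * k * sd z.1.
pose T4 := fun z : borel R N * borel R N => 3 * k * sd z.2.
have iT1 : g.-integrable D (EFin \o T1).
  by have := integrableZl mD (2 * k) intf; apply: eq_integrable.
have iT2 : g.-integrable D (EFin \o T2).
  by have := integrableZl mD b isg; apply: eq_integrable.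
have iT3 : g.-integrable D (EFin \o T3).
  by have := integrableZl mD (3 * k) is1; apply: eq_integrable.
have iT4 : g.-integrable D (EFin \o T4).
  by have := integrableZl mD (3 * k) is2; apply: eq_integrable.
have iT34 : g.-integrable D (EFin \o (fun z => T3 z + T4 z)).
  by have := integrableD mD iT3 iT4; apply: eq_integrable.
have iT234 : g.-integrable D (EFin \o (fun z => T2 z + (T3 z + T4 z))).
  by have := integrableD mD iT2 iT34; apply: eq_integrable.
apply: (@le_trans _ _ (\int[g]_(z in D) (T1 z + (T2 z + (T3 z + T4 z))))).
  apply: le_Rintegral => //.
  - by have := integrableB mD iF1g iF2g; apply: eq_integrable.
  - by have := integrableD mD iT1 iT234; apply: eq_integrable.
  - by move=> z [/eball0P z1 /eball0P z2]; exact: jet_fun_difference.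
rewrite RintegralD// RintegralD// RintegralD// /T1 /T2 /T3 /T4.
rewrite !RintegralZl// es es1 es2 !esd lerD//.
  by rewrite ler_wpM2l ?mulr_ge0.
by rewrite lerD2r ler_wpM2l// sq_Rintegral_le.
Qed.

Let A : set (borel R N) := annulus r rho.
Let Z : set (borel R N) := ~` eball 0 rho.

Let mA : measurable A. Proof. exact: measurable_annulus. Qed.
Let mZ : measurable Z. Proof. by apply: measurableC; exact: measurable_eball0. Qed.

Let M0 : 0 <= M. Proof. exact: le_trans (UM 0). Qed.

Let r0 : 0 < r. Proof. exact: lt_le_trans dr. Qed.

Let A_ge z : A z -> r <= enorm z.
Proof. by case=> _ /eball0P /negP; rewrite -leNgt. Qed.

Let Z_ge z : Z z -> rho <= enorm z.
Proof. by move=> /eball0P /negP; rewrite -leNgt. Qed.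

Let jet_fun_out (U' : E -> R) (x' P : E) kappa z : delta <= enorm z ->
  jet_fun U' x' P kappa delta z = U' (x' + z) - U' x' - \1_(eball 0 1) z * dot P z.
Proof. by rewrite /jet_fun ltNge => ->. Qed.

(** The maximum property at equal jumps [z1 = z2] is free of [p] and [k], so replacing [F1] by [F2]
    under [nux] costs only terms in [b] and [q], times the mass of the annulus. The change of
    measure then concerns [F2] alone. *)
Lemma mid_part (t : R) :
  \int[nux]_(z in A) F2 z - \int[nuy]_(z in A) F2 z <= t ->
  \int[nux]_(z in A) F1 z - \int[nuy]_(z in A) F2 z <=
  (b * rho ^+ 2 + enorm q * rho) * (C / r ^+ 2) + t.
Proof.
move=> tvt; have [Afin AC] := levy_tail nuxC mA (introT andP (conj r0 (ltW r1))) A_ge.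
have iF2x : nux.-integrable A (EFin \o (F2 : borel R N -> R)).
  exact: (jet_fun_integrable _ _ _ mV VM d0 d1 nuxC).
set K := b * rho ^+ 2 + enorm q * rho.
have rho0 : 0 <= rho by exact: le_trans rho1.
have K0 : 0 <= K by rewrite addr_ge0 ?mulr_ge0 ?sqr_ge0 ?enorm_ge0.
suff : \int[nux]_(z in A) F1 z - \int[nux]_(z in A) F2 z <= K * (C / r ^+ 2) by lra.
rewrite -RintegralB//; last exact: iF1.
apply: (@le_trans _ _ (\int[nux]_(z in A) K)).
  apply: le_Rintegral => //.
  - by have := integrableB mA (iF1 mA) iF2x; apply: eq_integrable.
  - by apply: (bounded_integrable (L := K)) => // z _; rewrite ger0_norm.
  move=> z Az; have rz := A_ge Az.
  have zrho : enorm z <= rho by case: Az => /eball0P /ltW.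
  rewrite /F1 /F2 !jet_fun_out ?(le_trans dr)//.
  have := UVmax z z; rewrite subrr dot0r enorm0 expr0n mulr0 !addr0 => h.
  have hb : b * enorm z ^+ 2 <= b * rho ^+ 2.
    by rewrite ler_wpM2l// ler_sqr ?nnegrE ?enorm_ge0.
  (* The compensator cancels the linear term inside the unit ball; outside it [|z| <= rho]. *)
  have hq : dot q z - \1_(eball 0 1) z * dot q z <= enorm q * rho.
    have [z1|z1] := pselect (eball 0 1 z).
      by rewrite indicE mem_set// mul1r subrr mulr_ge0 ?enorm_ge0.
    rewrite indicE memNset// mul0r subr0 (le_trans (ler_norm _))//.
    by rewrite (le_trans (dot_le _ _))// ler_wpM2l ?enorm_ge0.
  rewrite dotDl mulrDr; move: hq h hb; rewrite /K.
  move: (\1_(eball 0 1) z * _) (\1_(eball 0 1) z * _) => i1 i2; lra.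
rewrite Rintegral_cst// ler_wpM2l// ler_pdivlMr// ?exprn_gt0//.
Qed.

(** Beyond [rho >= 1] there is no compensator, so the gradients disappear and both integrands are
    bounded by [2 M]. *)
Lemma far_part (t : R) :
  (nux Z <= t%:E)%E -> (nuy Z <= t%:E)%E ->
  \int[nux]_(z in Z) F1 z - \int[nuy]_(z in Z) F2 z <= 4 * M * t.
Proof.
move=> tx ty.
have Zout z : Z z -> delta <= enorm z /\ \1_(eball 0 1) z = 0 :> R.
  move=> /Z_ge rz; split; first by rewrite (le_trans d1)// (le_trans rho1).
  rewrite indicE memNset// => /eball0P; apply/negP; rewrite -leNgt.
  exact: le_trans rz.
have cst (nu : {measure set (borel R N) -> \bar R}) : (nu Z <= t%:E)%E ->
    nu.-integrable Z (EFin \o cst (2 * M)) /\ \int[nu]_(z in Z) (2 * M) <= 2 * M * t.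
  move=> nut; have nuoo : (nu Z < +oo)%E by apply: (le_lt_trans nut); exact: ltry.
  split; first by apply: (bounded_integrable (L := 2 * M)) => // z _; rewrite ger0_norm ?mulr_ge0.
  rewrite Rintegral_cst// ler_wpM2l ?mulr_ge0//.
  by rewrite -lee_fin fineK// ge0_fin_numE.
have [icx cx] := cst _ tx; have [icy cy] := cst _ ty.
have bx : \int[nux]_(z in Z) F1 z <= 2 * M * t.
  apply: le_trans cx; apply: le_Rintegral => //; first exact: iF1.
  move=> z /Zout[dz iz]; rewrite /F1 jet_fun_out// iz mul0r subr0.
  rewrite (le_trans (ler_norm _))// (le_trans (ler_normB _ _))// mulr_natl mulr2n.
  by rewrite lerD.
have by_ : - (2 * M * t) <= \int[nuy]_(z in Z) F2 z.
  rewrite lerNl; apply: le_trans cy.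
  rewrite -mulN1r -RintegralZl//; last exact: iF2.
  apply: le_Rintegral => //.
    by have := integrableZl mZ (-1) (iF2 mZ); apply: eq_integrable.
  move=> z /Zout[dz iz]; rewrite /F2 jet_fun_out// iz mul0r subr0 mulN1r.
  rewrite (le_trans (ler_norm _))// normrN (le_trans (ler_normB _ _))// mulr_natl mulr2n.
  by rewrite lerD.
lra.
Qed.

Lemma Rintegral_split3 (nu : {measure set (borel R N) -> \bar R}) (f : borel R N -> R) :
  nu.-integrable setT (EFin \o f) ->
  \int[nu]_z f z = \int[nu]_(z in eball 0 r) f z + (\int[nu]_(z in A) f z +
                   \int[nu]_(z in Z) f z).
Proof.
move=> intf; have mB : measurable (eball 0 r : set (borel R N)) by exact: measurable_eball0.
have sub : (eball 0 r : set E) `<=` eball 0 rho.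
  by move=> z /eball0P zr; apply/eball0P; apply: (lt_le_trans zr); apply: le_trans rho1; exact: ltW.
have AZ : A `|` Z = ~` eball 0 r.
  apply/seteqP; split=> z.
    by case=> [[]//|zrho zr]; apply: zrho; exact: sub.
  by move=> zr; have [zrho|zrho] := pselect (eball 0 rho z); [left|right].
rewrite -(Rintegral_setU mA mZ); last 2 first.
- by apply: integrableS intf => //; exact: measurableU.
- by apply/disj_setPS => z [[zrho _] /(_ zrho)].
rewrite AZ -Rintegral_setU ?setUv//; first exact: measurableC.
by apply/disj_setPS; rewrite setICr.
Qed.

Lemma nonlocal_difference (g : {measure set (borel R N * borel R N)%type -> \bar R})
    (W tv tail : R) :
  admissible (eball 0 r) nux nuy g ->
  let f := fun z : borel R N * borel R N => enorm ((z.1 : E) - (z.2 : E)) ^+ 2 in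
  g.-integrable (eball 0 r `*` eball 0 r) (EFin \o f) ->
  \int[g]_(z in eball 0 r `*` eball 0 r) f z <= W ->
  \int[nux]_(z in A) F2 z - \int[nuy]_(z in A) F2 z <= tv ->
  (nux Z <= tail%:E)%E -> (nuy Z <= tail%:E)%E ->
  \int[nux]_z F1 z - \int[nuy]_z F2 z <=
  2 * k * W + (b * C + (3 * k * \int[nux]_(z in eball 0 delta) s z +
                        3 * k * \int[nuy]_(z in eball 0 delta) s z)) +
  ((b * rho ^+ 2 + enorm q * rho) * (C / r ^+ 2) + tv) + 4 * M * tail.
Proof.
move=> gadm f intf fW tvt tx ty.
have hn := near_part gadm intf fW; have hm := mid_part tvt; have hf := far_part tx ty.
rewrite (Rintegral_split3 (iF1 measurableT)) (Rintegral_split3 (iF2 measurableT)).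
lra.
Qed.

End NonlocalDifference.

(** * Comparison *)

Lemma jet_fun_scale (R : realType) (N : nat) (U : 'rV[R]_N -> R) x P kappa delta (mu : R) z :
  jet_fun (fun y => mu * U y) x (mu *: P) (mu * kappa) delta z =
  mu * jet_fun U x P kappa delta z.
Proof. by rewrite /jet_fun dotZl; case: ifP => _; ring. Qed.

Lemma jet_bound (R : realType) (N : nat) (U V : 'rV[R]_N -> R) (x0 X Y : 'rV[R]_N) (k b : R) :
  (forall x y, U x - V y - k * enorm (x - y) ^+ 2 - b * enorm (x - x0) ^+ 2 <=
    U X - V Y - k * enorm (X - Y) ^+ 2 - b * enorm (X - x0) ^+ 2) ->
  forall z1 z2, U (X + z1) - V (Y + z2) <= U X - V Y +
    dot ((2 * k) *: (X - Y)) (z1 - z2) + dot ((2 * b) *: (X - x0)) z1 +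
    k * enorm (z1 - z2) ^+ 2 + b * enorm z1 ^+ 2.
Proof.
move=> h z1 z2; have := h (X + z1) (Y + z2).
have -> : X + z1 - (Y + z2) = (X - Y) + (z1 - z2) by rewrite opprD addrACA.
have -> : X + z1 - x0 = (X - x0) + z1 by rewrite addrAC.
have e (u w : 'rV[R]_N) : enorm (u + w) ^+ 2 = enorm u ^+ 2 + 2 * dot u w + enorm w ^+ 2.
  by rewrite !sqr_enorm dotDl !dotDr (dotC w u); ring.
rewrite (e (X - Y)) (e (X - x0)) !dotZl.
move: (enorm _ ^+ 2) (enorm (X - x0) ^+ 2) => a1 a2.
lra.
Qed.

Theorem theorem2p8 (R : realType) (N : nat) (lambda : R)
  (nu : 'rV[R]_N -> {measure set (borel R N) -> \bar R})
  (nuL : forall xi, levy_measure (nu xi))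
  (H : 'rV[R]_N -> 'rV[R]_N -> R) (m : R) (u v : 'rV[R]_N -> R) :
  0 < lambda ->
  levy_bounded nu ->
  levy_tight nu ->
  tv_continuous nuL ->
  wasserstein_holder nu ->
  continuous (fun xp : 'rV[R]_N * 'rV[R]_N => H xp.1 xp.2) ->
  1 < m ->
  hamiltonian_continuity m H ->
  hamiltonian_superlinear m H ->
  viscosity_subsolution lambda nu H u ->
  viscosity_supersolution lambda nu H v ->
  forall x, u x <= v x.
Proof.
move=> la0 [C C0 nuC'] tight tvc [r00 [ osc [/andP[r00_gt0 r00_lt1] osc_ge0 osc_cvg W2]]] cH m1 H1 H2.
move=> subu superv xs; have [uscu [mu_ [Mu uM]] _] := subu.
have [lscv [mv [Mv vM]] _] := superv.
have nuC x : (\int[nu x]_z (levy_weight z)%:E <= C%:E)%E.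
  by apply: le_trans nuC'; apply: ereal_sup_ubound; exists x.
pose M := Num.max Mu Mv + 1.
have uM1 x : `|u x| <= M.
  by rewrite (le_trans (uM x))// /M ler_wpDr// le_max lexx.
have vM1 x : `|v x| <= M.
  by rewrite (le_trans (vM x))// /M ler_wpDr// le_max lexx orbT.
have M0 : 0 < M.
  have : 0 <= Num.max Mu Mv by rewrite le_max (le_trans _ (uM 0)).
  by rewrite /M; lra.
rewrite leNgt; apply/negP => vu.
pose th := u xs - v xs; have th0 : 0 < th by rewrite subr_gt0.
(* The remaining gap gives [lambda * th / 2 = 16 eta]. The losses are eight times [eta]: one from
   the Hamiltonian, one from [lambda * b], six from the nonlocal terms. *)
pose eta := lambda * th / 32.
have eta0 : 0 < eta by rewrite divr_gt0// mulr_gt0.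
have [mu1 /andP[mu1_gt0 mu1_lt1] Hmu] := ham_lower cH m1 H1 H2 eta0.
(* Multiplying [u] by [t] may use up at most half of the gap [th]. *)
have [t [t0 t1 tM tmu]] : exists t : R, [/\ 0 < t, t < 1, (1 - t) * M <= th / 2 & mu1 <= t].
  exists (1 - Num.min (1 - mu1) (th / (2 * M))); split.
  - by rewrite subr_gt0 gt_min ltrBlDl ltrDr mu1_gt0.
  - by rewrite ltrBlDl ltrDr lt_min subr_gt0 mu1_lt1 divr_gt0// mulr_gt0.
  - rewrite opprB addrCA subrr addr0 -ler_pdivlMr//.
    by rewrite ge_min; apply/orP; right; rewrite invfM mulrA.
  - by rewrite lerBrDl -lerBrDr ge_min lexx.
have [c [d [c0 d0 Hcd]]] := Hmu t (introT andP (conj tmu t1)).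
pose U x := t * u x.
have UM x : `|U x| <= M.
  rewrite normrM gtr0_norm// (le_trans _ (uM1 x))// ler_piMl//; exact: ltW.
have mU : measurable_fun [set: borel R N] (U : borel R N -> R).
  exact: measurable_funM.
have uscU : upper_semicontinuous U.
  move=> x a; rewrite /U mulrC -ltr_pdivlMr// => /uscu; apply: filterS => y.
  by rewrite ltr_pdivlMr// mulrC.
have lscV x a : a < v x -> \forall y \near x, a < v y.
  move=> av; have := lscv x a; rewrite /= lte_fin => /(_ av).
  by case => A nA AP; apply: filterS nA => y /AP; rewrite /= lte_fin.
(* A number in [[0, 1]] dominates its square, so this gives [osc r ^+ 2 <= c / 2]: the transport
   cost takes half of [c |p|], and the total variation takes the other half through [e2]. *)
pose e1 := Num.min 1 (c / 2).
have e10 : 0 < e1 by rewrite lt_min ltr01 divr_gt0.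
have [d1 d10 od1] := cvg_at_right0_le osc_cvg e10.
pose r := Num.min d1 r00 / 2.
have rm0 : 0 < Num.min d1 r00 by rewrite lt_min d10.
have r0 : 0 < r by rewrite divr_gt0.
have rlt : r < Num.min d1 r00 by rewrite /r ltr_pdivrMr// ltr_pMr// ltr1n.
have [rd1 rr00] : r < d1 /\ r < r00 by move: rlt; rewrite lt_min => /andP.
have or0 : 0 <= osc r by apply: osc_ge0; rewrite r0.
have or2 : osc r ^+ 2 <= c / 2.
  have ore : osc r <= e1 by apply: od1; rewrite r0.
  have [ os1 os2] : osc r <= 1 /\ osc r <= c / 2 by move: ore; rewrite le_min => /andP.
  by rewrite expr2 (le_trans _ os2)// ler_piMl.
have r1 : r < 1 by exact: lt_trans r00_lt1.
pose tail := eta / (4 * M).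
have tail0 : 0 < tail by rewrite divr_gt0// mulr_gt0.
have [rho [rho1 rhoP]] : exists rho : R, 1 <= rho /\
    forall xi, (nu xi (~` eball 0 rho) <= tail%:E)%E.
  have : \forall rho \near +oo,
      (ereal_sup [set nu xi (~` eball 0 rho) | xi in [set: 'rV[R]_N]] < tail%:E)%E.
    apply: (tight [set t : \bar R | t < tail%:E]%E); apply: open_nbhs_nbhs.
    by split; [exact: open_ereal_lt_ereal|rewrite /= lte_fin].
  move=> hn; have [rho [h1 h2]] : exists rho : R, 1 <= rho /\
      (ereal_sup [set nu xi (~` eball 0 rho) | xi in [set: 'rV[R]_N]] < tail%:E)%E.
    apply: (@filter_ex _ +oo%R); apply: filterI => //.
    apply: nbhs_pinfty_ge; exact: num_real.
  exists rho; split => // xi; apply: le_trans (ltW h2).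
  by apply: ereal_sup_ubound; exists xi.
have rrho : r < rho by exact: lt_le_trans rho1.
have [ omg [om0 omc] omP] := tvc r rho r0 rrho.
pose e2 := Num.min (c / 2) (eta / (2 * M)).
have e20 : 0 < e2 by rewrite lt_min; apply/andP; split; rewrite divr_gt0// mulr_gt0.
have [d3 d30 od3] := cvg_at_right0_le omc e20.
(* [|X - Y| < L] serves both the Hamiltonian estimate and the modulus of the total variation; [k] is
   then the value required by [doubling_max]. *)
pose L := Num.min d d3; have L0 : 0 < L by rewrite lt_min d0.
pose k := (4 * M + 2) / L ^+ 2.
have L20 : 0 < L ^+ 2 by rewrite exprn_gt0.
have k0 : 0 < k by rewrite divr_gt0// addr_gt0// mulr_gt0.
have kL : k * L ^+ 2 = 4 * M + 2 by rewrite divfK// gt_eqF.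
pose Kr := (rho ^+ 2 + 2 * rho) * (C / r ^+ 2).
have rho0 : 0 < rho by exact: lt_le_trans rho1.
have Kr0 : 0 < Kr.
  by rewrite mulr_gt0 ?divr_gt0 ?exprn_gt0// addr_gt0 ?exprn_gt0// mulr_gt0.
have [b [b0 b1 bd [bl bC bK]]] : exists b : R, [/\ 0 < b, b <= 1, b < d / 2 &
    [/\ lambda * b <= eta, b * C <= eta & b * Kr <= eta]].
  pose bb := Num.min 1 (Num.min (d / 4) (Num.min (eta / lambda)
    (Num.min (eta / C) (eta / Kr)))).
  have bb0 : 0 < bb by rewrite !lt_min ltr01/=; do ?[apply/andP; split]; apply: divr_gt0.
  have : [/\ bb <= 1, bb <= d / 4, bb <= eta / lambda, bb <= eta / C & bb <= eta / Kr].
    by split; rewrite /bb !ge_min lexx ?orbT.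
  case=> b1 b2 b3 b4 b5; exists bb; split => //.
    by move: b2 d0; clear; lra.
  by split; rewrite ?[lambda * _]mulrC -ler_pdivlMr.
have [x0 [X [Y [Xx0 XY diag XYmax]]]] :=
  doubling_max uscU lscV UM vM1 b0 b1 k0 L0 kL.
have UVmax := jet_bound XYmax.
set p := (2 * k) *: (X - Y) in UVmax; set q := (2 * b) *: (X - x0) in UVmax.
have qb : enorm q <= 2 * b.
  rewrite enormZ ger0_norm ?mulr_ge0 ?(ltW b0)//.
  by rewrite ler_piMr// mulr_ge0 ?(ltW b0).
have pe : enorm p = 2 * k * enorm (X - Y).
  by rewrite enormZ ger0_norm// mulr_ge0 ?(ltW k0).
have [XYd XYd3] : enorm (X - Y) < d /\ enorm (X - Y) < d3.
  by move: XY; rewrite lt_min => /andP.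
have hH := Hcd X Y p q XYd (le_lt_trans qb _).
have {}hH : c * enorm p - eta <= t * H X (t^-1 *: (p + q)) - H Y p.
  by apply: hH; rewrite mulrC -ltr_pdivlMr.
(* The slack of the coupling is multiplied by [2k] in the estimate; likewise [e4] below by [3k],
   once for each of [X] and [Y]. *)
pose e3 := eta / (2 * k).
have e30 : 0 < e3 by rewrite divr_gt0// mulr_gt0.
have rI : 0 < r < r00 by rewrite r0.
have [g gadm [ig gW]] := wasserstein_coupling
  (mulr_ge0 or0 (powR_ge0 (enorm (X - Y)) 2^-1)) e30 (W2 r rI X Y).
have sqW : (osc r * enorm (X - Y) `^ 2^-1) ^+ 2 = osc r ^+ 2 * enorm (X - Y).
  rewrite exprMn; congr (_ * _).
  by rewrite -powR_mulrn ?powR_ge0// -powRrM mulVf ?pnatr_eq0// powRr1// enorm_ge0.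
rewrite sqW in gW.
pose e4 := eta / (6 * k); have e40 : 0 < e4 by rewrite divr_gt0// mulr_gt0.
have [dX /andP[dX0 _] dXP] := small_ball (nuC X) e40.
have [dY /andP[dY0 _] dYP] := small_ball (nuC Y) e40.
pose delta := Num.min r (Num.min dX dY).
have de0 : 0 < delta by rewrite !lt_min r0 dX0.
have [der deX deY] : [/\ delta <= r, delta <= dX & delta <= dY].
  by split; rewrite /delta !ge_min lexx ?orbT.
have de1 : delta <= 1 by rewrite (le_trans der)// ltW.
have SX := dXP delta (introT andP (conj de0 deX)).
have SY := dYP delta (introT andP (conj de0 deY)).
(* The maximum property concerns [t u], whereas the equation is tested with [u]: gradient and
   curvature are divided by [t], and the resulting inequality is later multiplied by [t]. *)
pose P := t^-1 *: (p + q); pose kap := t^-1 * (k + b).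
have t_neq0 : t != 0 by rewrite gt_eqF.
have subj := @subsolution_jet _ _ lambda nu H u X P kap delta subu.
have {}subj : lambda * u X - \int[nu X]_z jet_fun u X P kap delta z + H X P <= 0.
  rewrite -(jet_fun_split _ _ mu_ uM1 de0 de1 (nuC X)).
  have := subj (introT andP (conj de0 de1)); rewrite opprD addrA; apply => z _.
  rewrite -(ler_pM2l t0) /P /kap dotZl dotDl.
  have := UVmax z 0; rewrite subr0 addr0 /U => h.
  have -> : t * (u X + t^-1 * (dot p z + dot q z) + t^-1 * (k + b) * enorm z ^+ 2) =
    t * u X + dot p z + dot q z + (k + b) * enorm z ^+ 2 by field.
  by move: h; clear; lra.
have supj := @supersolution_jet _ _ lambda nu H v Y p (- k) delta superv.
have {}supj : 0 <= lambda * v Y - \int[nu Y]_z jet_fun v Y p (- k) delta z + H Y p.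
  rewrite -(jet_fun_split _ _ mv vM1 de0 de1 (nuC Y)).
  have := supj (introT andP (conj de0 de1)); rewrite opprD addrA; apply => z _.
  have := UVmax 0 z; rewrite !sub0r addr0 !enormN enorm0 expr0n mulr0 dotNr dot0r => h.
  by move: h; clear; lra.
have eF1 : \int[nu X]_z jet_fun U X (p + q) (k + b) delta z =
    t * \int[nu X]_z jet_fun u X P kap delta z.
  rewrite -RintegralZl//; last exact: (jet_fun_integrable _ _ _ mu_ uM1 de0 de1 (nuC X)).
  apply: eq_Rintegral => z _; rewrite -jet_fun_scale /P /kap scalerA mulrA.
  by rewrite divff// scale1r mul1r.
set A : set (borel R N) := annulus r rho.
pose tv := (2 * M + enorm p) * e2.
have Mp0 : 0 <= 2 * M + enorm p by rewrite addr_ge0 ?enorm_ge0// mulr_ge0// ltW.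
have htv : \int[nu X]_(z in A) jet_fun v Y p (- k) delta z -
    \int[nu Y]_(z in A) jet_fun v Y p (- k) delta z <= tv.
  (* The modulus may be positive at 0, but for [X = Y] the two integrals coincide. *)
  have [XeqY|XneY] := eqVneq X Y.
    by rewrite XeqY subrr /tv mulr_ge0// ltW.
  have XY0 : 0 < enorm (X - Y).
    rewrite lt_neqAle enorm_ge0 andbT eq_sym; apply/eqP => /enorm_eq0 /eqP.
    by rewrite subr_eq0 (negPf XneY).
  have omXY : omg (enorm (X - Y)) <= e2 by apply: od3; rewrite XY0.
  apply: (@le_trans _ _ ((2 * M + enorm p) * omg (enorm (X - Y)))); last first.
    by rewrite /tv ler_wpM2l.
  apply: tv_Rintegral (omP X Y) => //.
    by apply: measurable_funTS; exact: measurable_jet_fun.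
  move=> z [_ /eball0P /negP]; rewrite -leNgt => rz.
  by apply: jet_fun_le => //; exact: le_trans rz.
have main := nonlocal_difference (nuC X) (nuC Y) mU mv UM vM1 (ltW k0) (ltW b0)
  de0 der r1 rho1 UVmax gadm ig gW htv (rhoP X) (rhoP Y).
have b1' : 2 * k * (osc r ^+ 2 * enorm (X - Y) + e3) <= c / 2 * enorm p + eta.
  have -> : 2 * k * (osc r ^+ 2 * enorm (X - Y) + e3) = osc r ^+ 2 * enorm p + eta.
    by rewrite pe /e3; field; rewrite gt_eqF.
  by rewrite lerD2r ler_wpM2r ?enorm_ge0.
have b2' : 3 * k * \int[nu X]_(z in eball 0 delta) (enorm (z : 'rV[R]_N) ^+ 2) +
    3 * k * \int[nu Y]_(z in eball 0 delta) (enorm (z : 'rV[R]_N) ^+ 2) <= eta.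
  have -> : eta = 3 * k * e4 + 3 * k * e4 by rewrite /e4; field; rewrite gt_eqF.
  by apply: lerD; rewrite ler_wpM2l// mulr_ge0// ltW.
have b3' : (b * rho ^+ 2 + enorm q * rho) * (C / r ^+ 2) <= eta.
  apply: le_trans bK; rewrite /Kr [b * (_ * _)]mulrA.
  apply: ler_wpM2r; first by rewrite divr_ge0 ?sqr_ge0 ?(ltW C0).
  by have := ler_wpM2r (ltW rho0) qb; clear; lra.
have b4' : tv <= eta + c / 2 * enorm p.
  have ec : e2 <= c / 2 by rewrite ge_min lexx.
  have ee : e2 <= eta / (2 * M) by rewrite ge_min lexx orbT.
  rewrite /tv mulrDl; apply: lerD.
    by rewrite mulrC -ler_pdivlMr// mulr_gt0.
  by rewrite mulrC ler_wpM2r ?enorm_ge0.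
have b5' : 4 * M * tail = eta by rewrite /tail; field; rewrite gt_eqF.
have subt : t * (lambda * u X - \int[nu X]_z jet_fun u X P kap delta z + H X P) <= 0.
  by rewrite pmulr_rle0.
have dg := ler_wpM2l (ltW la0) (diag xs).
have us : U xs - v xs >= th / 2.
  have := uM1 xs; rewrite ler_norml => /andP[_ uh].
  have : (1 - t) * u xs <= (1 - t) * M by rewrite ler_wpM2l// subr_ge0 ltW.
  by move: tM; rewrite /U /th; clear; lra.
have lth := ler_wpM2l (ltW la0) us.
have e8 : eta = lambda * th / 32 by [].
have : eta <= 0.
  move: main; rewrite eF1; move: subt supj hH dg lth; rewrite /U /P.
  move: (\int[nu X]_z jet_fun _ _ _ _ _ _) (\int[nu Y]_z jet_fun _ _ _ _ _ _) => I1 I2.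
  move: b2'; set S1 := 3 * k * _; set S2 := 3 * k * _ => b2'.
  by move: b1' b2' b3' b4' b5' bl bC e8; clear; lra.
by rewrite leNgt eta0.
Qed.
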